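(* Let $C$ be a random vector in $\mathbb{R}_+^n$ satisfying the asymptotic homogeneity assumption (stated in the context) with exponent $\alpha$ and function $h$. Let $\ell_1,\ell_2,\dots$ be independent copies of $\ell(p)=\langle C,p\rangle$, $p\in\overline{\Delta}_n$, and let $\Psi_K=K^{\frac1{n+\alpha}}\min_{1\le k\le K}\ell_k$. Let $p^{(1)},\dots,p^{(r)}$ be distinct points of $\Delta_n$, let $a_1,\dots,a_r>0$, and let $$\widehat{R}(\mathbf{p},\mathbf{a})=\bigcup_{i=1}^rR(p^{(i)},a_i),\qquad R(p,a)=\{x\in\mathbb{R}_+^n:\langle p,x\rangle<a\}.$$ Then $$\lim_{K\to\infty}\mathbb{P}\big(\Psi_K(p^{(i)})\ge a_i,\ i=1,\dots,r\big)=\exp\Big(-\int_{\widehat{R}(\mathbf{p},\mathbf{a})}h(x)\,dx\Big).$$ Thus the joint distribution of the random vector $(\Psi_K(p^{(i)}))_{1\le i\le r}$ converges weakly to the distribution defined by the right-hand side (as a function of $(a_1,\dots,a_r)$). In particular, for fixed $p\in\Delta_n$, if $\Psi(p)$ is a real random variable distributed as the weak limit of $\Psi_K(p)$ as $K\to\infty$, then $\Psi(p)^{n+\alpha}$ is exponentially distributed with rate $\int_{R(p,1)}h(y)\,dy$.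
   Context: Let $n\ge2$, $\mathbb{R}_+^n:=(0,\infty)^n$, $\Delta_n:=\{p\in(0,1)^n:p_1+\cdots+p_n=1\}$, $\overline{\Delta}_n$ its closure, $\langle p,x\rangle=\sum_ip_ix_i$. Asymptotic homogeneity assumption: $C=(C_1,\dots,C_n)$ has a joint density $\rho$ on $\mathbb{R}_+^n$, and there exist $\alpha\in\mathbb{R}$ and a non-negative measurable function $h$ on $\mathbb{R}_+^n$ with $\int_{\mathbb{R}_+^n}h(x)\,dx\in(0,\infty]$ such that $\lim_{\kappa\to0^+}\kappa^{-\alpha}\rho(\kappa x)=h(x)$ for $x\in\mathbb{R}_+^n$, uniformly for $x\in\Delta_n$. (Under this assumption $\alpha$ is uniquely determined, $\alpha>-n$, $h$ is homogeneous of order $\alpha$, and $h$ is integrable on bounded Borel subsets of $\mathbb{R}_+^n$.) *)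

(* Defs.v *)
From HB Require Import structures.
From mathcomp Require Import all_boot all_order all_algebra finmap.
From mathcomp Require Import all_classical all_reals all_analysis.

Set Implicit Arguments.
Unset Strict Implicit.
Unset Printing Implicit Defensive.

Import Order.TTheory GRing.Theory Num.Theory.
Import numFieldNormedType.Exports.

Local Open Scope classical_set_scope.
Local Open Scope ring_scope.

(* Row vectors carry the sigma-algebra generated by the coordinates; for real
   entries this is the Borel sigma-algebra of R^n. *)
Definition rV_display : measure_display -> measure_display.
Proof. exact. Qed.

Section measurable_rV.
Context {d : measure_display} {T : measurableType d} (n : nat).

Let coord : 'I_n -> 'rV[T]_n -> T := fun i x => x 0 i.

Let rV_set0 : g_sigma_preimage coord set0.
Proof. exact: sigma_algebra0. Qed.

Let rV_setC A : g_sigma_preimage coord A -> g_sigma_preimage coord (~` A).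
Proof. exact: sigma_algebraC. Qed.

Let rV_bigcup (F : _^nat) : (forall i, g_sigma_preimage coord (F i)) ->
  g_sigma_preimage coord (\bigcup_i (F i)).
Proof. exact: sigma_algebra_bigcup. Qed.

HB.instance Definition _ := @isMeasurable.Build (rV_display d)
  'rV[T]_n (g_sigma_preimage coord) rV_set0 rV_setC rV_bigcup.

End measurable_rV.

Lemma measurable_coord {d : measure_display} {T : measurableType d} (n : nat)
  (i : 'I_n) : measurable_fun [set: 'rV[T]_n] (fun x : 'rV[T]_n => x 0 i).
Proof.
move=> _ Y mY; rewrite setTI; apply: sub_sigma_algebra => /=.
rewrite -bigcup_seq/=; exists i => /=; first by rewrite mem_index_enum.
by exists Y => //; rewrite setTI.
Qed.

Lemma measurable_fun_rVP {d d' : measure_display} {T : measurableType d}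
    {U : measurableType d'} (n : nat) (f : U -> 'rV[T]_n) :
  (forall i, measurable_fun [set: U] (fun u => f u 0 i)) ->
  measurable_fun [set: U] f.
Proof.
pose G := \big[setU/set0]_(i < n)
  preimage_set_system setT (fun x : 'rV[T]_n => x 0 i) measurable.
move=> mf; apply: (@measurability _ _ _ _ _ _ G) => // _ [Y + <-].
rewrite /G -bigcup_seq/= => -[i _ [B mB <-]].
by rewrite setTI; exact: mf.
Qed.

Section lebesgue_rV.
Context {R : realType}.

(* The identification R * R^n = R^(n+1); note that (1 + n)%N is n.+1. *)
Definition consrV (n : nat) (x : R * 'rV[R]_n) : 'rV[R]_n.+1 :=
  row_mx (x.1)%:M x.2.

Definition unconsrV (n : nat) (y : 'rV[R]_n.+1) : R * 'rV[R]_n :=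
  (y 0 ord0, \row_i y 0 (lift ord0 i)).

Lemma consrV0 n x : @consrV n x 0 ord0 = x.1.
Proof.
have -> : ord0 = lshift n (0 : 'I_1) :> 'I_(1 + n) by exact/val_inj.
by rewrite [LHS]row_mxEl mxE eqxx mulr1n.
Qed.

Lemma consrVS n x i : @consrV n x 0 (lift ord0 i) = x.2 0 i.
Proof.
have -> : lift ord0 i = rshift 1 i :> 'I_(1 + n) by exact/val_inj.
by rewrite [LHS]row_mxEr.
Qed.

Lemma unconsrVK n : cancel (@unconsrV n) (@consrV n).
Proof.
move=> y; apply/rowP => i; have [j ->|->] := unliftP ord0 i.
  by rewrite consrVS mxE.
by rewrite consrV0.
Qed.

Lemma consrVK n : cancel (@consrV n) (@unconsrV n).
Proof.
move=> [x y]; rewrite /unconsrV consrV0; congr pair.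
by apply/rowP => i; rewrite mxE consrVS.
Qed.

Lemma measurable_consrV n :
  measurable_fun [set: measurableTypeR R * 'rV[R]_n] (@consrV n).
Proof.
apply: measurable_fun_rVP => i; have [j ->|->] := unliftP ord0 i.
  rewrite (_ : (fun _ => _) = (fun y : 'rV[R]_n => y 0 j) \o snd).
    by apply: measurableT_comp => //; exact: measurable_coord.
  by apply/funext => x; rewrite consrVS.
rewrite (_ : (fun _ => _) = fst); first exact: measurable_fst.
by apply/funext => x; rewrite consrV0.
Qed.

Lemma measurable_unconsrV n :
  measurable_fun [set: 'rV[R]_n.+1]
    (@unconsrV n : 'rV[R]_n.+1 -> measurableTypeR R * 'rV[R]_n).
Proof.
apply: measurable_fun_pair; first exact: measurable_coord.
apply: measurable_fun_rVP => i.
by under eq_fun do rewrite mxE; exact: measurable_coord.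
Qed.

Section lebesgue_cons.
Context (n : nat) (mu : {sigma_finite_measure set 'rV[R]_n -> \bar R}).

Definition lebesgue_cons : set 'rV[R]_n.+1 -> \bar R :=
  pushforward (@lebesgue_measure R \x mu)%E (@consrV n).

Let measurable_preim (A : set 'rV[R]_n.+1) : measurable A ->
  measurable (@consrV n @^-1` A : set (measurableTypeR R * 'rV[R]_n)).
Proof.
by move=> mA; rewrite -[X in measurable X]setTI; exact: measurable_consrV.
Qed.

Let lebesgue_cons0 : lebesgue_cons set0 = 0%E.
Proof. by rewrite /lebesgue_cons/pushforward preimage_set0 measure0. Qed.

Let lebesgue_cons_ge0 A : (0 <= lebesgue_cons A)%E.
Proof. exact: (measure_ge0 (@lebesgue_measure R \x mu)%E). Qed.

Let lebesgue_cons_sigma_additive : semi_sigma_additive lebesgue_cons.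
Proof.
move=> F mF tF mUF; rewrite /lebesgue_cons/pushforward preimage_bigcup.
apply: measure_semi_sigma_additive.
- by move=> k; exact: measurable_preim.
- apply/trivIsetP => /= i j _ _ ij; rewrite -preimage_setI.
  by move/trivIsetP : tF => /(_ _ _ _ _ ij) ->//; rewrite preimage_set0.
- by rewrite -preimage_bigcup; exact: measurable_preim.
Qed.

HB.instance Definition _ := isMeasure.Build _ _ _ lebesgue_cons
  lebesgue_cons0 lebesgue_cons_ge0 lebesgue_cons_sigma_additive.

Let lebesgue_cons_sigma_finite : sigma_finite setT lebesgue_cons.
Proof.
have /sigma_finiteP[F [TF ndF Foo]] := sigma_finiteT (@lebesgue_measure R).
have /sigma_finiteP[G [TG ndG Goo]] := sigma_finiteT mu.
exists (fun k => @unconsrV n @^-1` (F k `*` G k)).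
  apply/esym; rewrite -subTset => y _.
  have [k _ Fk] : (\bigcup_k F k) (unconsrV y).1 by rewrite -TF.
  have [l _ Gl] : (\bigcup_k G k) (unconsrV y).2 by rewrite -TG.
  exists (maxn k l) => //; split.
  - by move: Fk; exact/subsetPset/ndF/leq_maxl.
  - by move: Gl; exact/subsetPset/ndG/leq_maxr.
move=> k; have [mFk Fkoo] := Foo k; have [mGk Gkoo] := Goo k; split.
  rewrite -[X in measurable X]setTI; apply: measurable_unconsrV => //.
  exact: measurableX.
rewrite /lebesgue_cons/pushforward -comp_preimage.
rewrite (_ : _ \o _ = id); last by apply/funext => x /=; exact: consrVK.
by rewrite preimage_id product_measure1E// lte_mul_pinfty// ge0_fin_numE.
Qed.

HB.instance Definition _ := Measure_isSigmaFinite.Build _ _ _ lebesgue_cons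
  lebesgue_cons_sigma_finite.

End lebesgue_cons.

(* Lebesgue measure on R^n, as the n-fold product of Lebesgue measure on R;
   lebesgue_rV_box characterises it. *)
Fixpoint lebesgue_rV (n : nat) :
    {sigma_finite_measure set 'rV[R]_n -> \bar R} :=
  match n with
  | 0 => @dirac _ 'rV[R]_0 0 R
  | n'.+1 => lebesgue_cons (lebesgue_rV n')
  end.

Lemma lebesgue_rV_box (n : nat) (A : 'I_n -> set R) :
  (forall i, measurable (A i)) ->
  lebesgue_rV n [set x | forall i, A i (x 0 i)] =
  (\prod_(i < n) lebesgue_measure (A i))%E.
Proof.
elim: n A => [|n IHn] A mA.
  by rewrite big_ord0 /= diracE mem_set// => -[].
rewrite big_ord_recl -IHn => [|i]; last exact: mA.
have mB : measurable [set x : 'rV[R]_n | forall i, A (lift ord0 i) (x 0 i)].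
  rewrite (_ : [set _ | _] = \bigcap_(i in [set: 'I_n])
      ((fun x : 'rV[R]_n => x 0 i) @^-1` A (lift ord0 i))).
    apply: fin_bigcap_measurable => // i _.
    by rewrite -[X in measurable X]setTI; exact: measurable_coord.
  by apply/seteqP; split=> [x xA i _|x xA i]; exact: xA.
have mA0 : measurable (A ord0 : set (measurableTypeR R)) by exact: mA.
rewrite -(product_measure1E lebesgue_measure (lebesgue_rV n) mA0 mB).
congr product_measure1; apply/seteqP; split=> -[x y] /= xyA.
  split; first by have := xyA ord0; rewrite consrV0.
  by move=> i; have := xyA (lift ord0 i); rewrite consrVS.
move=> i; have [j ->|->] := unliftP ord0 i; rewrite ?consrVS ?consrV0; last exact: xyA.1.
exact: xyA.2.
Qed.

End lebesgue_rV.

Section simplex.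
Context {R : realType} (n : nat).

Definition orthant : set 'rV[R]_n := [set x | forall i, 0 < x 0 i].

Definition simplex : set 'rV[R]_n :=
  [set p | (forall i, 0 < p 0 i < 1) /\ \sum_i p 0 i = 1].

Definition dotr (p x : 'rV[R]_n) : R := \sum_i p 0 i * x 0 i.

Definition region (p : 'rV[R]_n) (a : R) : set 'rV[R]_n :=
  [set x | orthant x /\ dotr p x < a].

Definition region_union (r : nat) (p : 'I_r -> 'rV[R]_n) (a : 'I_r -> R) :
    set 'rV[R]_n :=
  \bigcup_(i in [set: 'I_r]) region (p i) (a i).

End simplex.

Section asymptotic_homogeneity.
Context {R : realType} (n : nat).

Definition nonneg_measurable (f : 'rV[R]_n -> R) :=
  measurable_fun (@orthant R n) f /\ forall x, orthant x -> 0 <= f x.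

(* rho is only used on the open orthant, which therefore carries all the mass
   of C. *)
Definition has_density {d : measure_display} {T : measurableType d}
    (P : probability T R) (C : T -> 'rV[R]_n) (rho : 'rV[R]_n -> R) :=
  nonneg_measurable rho /\
  forall B : set 'rV[R]_n, measurable B ->
    P (C @^-1` B) =
    (\int[@lebesgue_rV R n]_(x in B `&` @orthant R n) (rho x)%:E)%E.

Definition asymptotically_homogeneous {d : measure_display}
    {T : measurableType d} (P : probability T R) (C : T -> 'rV[R]_n)
    (alpha : R) (h : 'rV[R]_n -> R) :=
  nonneg_measurable h /\
  (0 < \int[@lebesgue_rV R n]_(x in @orthant R n) (h x)%:E)%E /\
  exists rho : 'rV[R]_n -> R,
    [/\ has_density P C rho,
        forall x, orthant x ->
          kappa `^ (- alpha) * rho (kappa *: x) @[kappa --> 0^'+] --> h x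
      & {uniform @simplex R n,
          (fun x => kappa `^ (- alpha) * rho (kappa *: x))
            @[kappa --> 0^'+] --> h}].

End asymptotic_homogeneity.

Section random_functions.
Context {R : realType} {I : Type} (D : set I).

(* A random function on D is a map X : I -> T -> R of which only the values
   X p with p in D matter. *)
Definition random_function {d : measure_display} {T : measurableType d}
    (X : I -> T -> R) :=
  forall p, D p -> measurable_fun [set: T] (X p).

(* Equality of all finite-dimensional distributions. *)
Definition same_law {d d' : measure_display} {T : measurableType d}
    {T' : measurableType d'} (P : probability T R) (P' : probability T' R)
    (X : I -> T -> R) (Y : I -> T' -> R) :=
  forall (m : nat) (q : 'I_m -> I), (forall j, D (q j)) ->
  forall B : set 'rV[R]_m, measurable B ->
    P [set w | B (\row_j X (q j) w)] = P' [set w | B (\row_j Y (q j) w)].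

Definition generated_sigma_algebra {d : measure_display} {T : measurableType d}
    (X : I -> T -> R) : set (set T) :=
  <<s \bigcup_(p in D) preimage_set_system [set: T] (X p) measurable >>.

Definition independent_functions {d : measure_display} {T : measurableType d}
    (P : probability T R) (X : nat -> I -> T -> R) :=
  forall (J : {fset nat}) (A : nat -> set T),
    (forall k, k \in J -> generated_sigma_algebra (X k) (A k)) ->
  P (\bigcap_(k in [set` J]) A k) = (\prod_(k <- J) P (A k))%E.

Definition independent_copies {d d' : measure_display} {T : measurableType d}
    {T' : measurableType d'} (P : probability T R) (P' : probability T' R)
    (X : nat -> I -> T -> R) (Y : I -> T' -> R) :=
  [/\ forall k, random_function (X k),
      forall k, same_law P P' (X k) Y
    & independent_functions P X].

End random_functions.

(* Weak convergence of the laws of X K to the law of Y; Y may live on another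
   probability space, and Y = id gives weak convergence to P' itself. *)
Definition cvg_in_distribution {R : realType} {E : topologicalType}
    {d d' : measure_display} {T : measurableType d} {T' : measurableType d'}
    (P : probability T R) (X : nat -> T -> E)
    (P' : probability T' R) (Y : T' -> E) :=
  forall f : E -> R, continuous f -> (exists M, forall x, `|f x| <= M) ->
    (\int[P]_w (f (X K w))%:E)%E @[K --> \oo] --> (\int[P']_w (f (Y w))%:E)%E.

(* The sequence ell is indexed from 0, so that ell 0, ..., ell K.-1 are the
   first K terms; the initial value ell 0 p w of the iterated minimum is one of
   them whenever K > 0. *)
Definition scaled_min {R : realType} {n : nat} {T : Type} (alpha : R)
    (ell : nat -> 'rV[R]_n -> T -> R) (K : nat) (p : 'rV[R]_n) (w : T) : R :=
  K%:R `^ (n%:R + alpha)^-1 * \big[Num.min/ell 0 p w]_(k < K) ell k p w.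

(* Main.v *)
Require Import Defs.
From HB Require Import structures.
From mathcomp Require Import all_boot all_order all_algebra finmap.
From mathcomp Require Import all_classical all_reals all_analysis.
From mathcomp Require Import measurable_realfun.
From mathcomp Require Import ring lra.

Set Implicit Arguments.
Unset Strict Implicit.
Unset Printing Implicit Defensive.

Import Order.TTheory GRing.Theory Num.Theory.
Import numFieldNormedType.Exports.

Local Open Scope classical_set_scope.
Local Open Scope ring_scope.

(** Throughout, [beta = n + alpha] and [nu] denotes the measure of density [h]
    on the open orthant.

    The value [Psi_K (p i)] lies below [a i] for some [i] exactly when one of the
    first [K] copies of [C] falls in [K^(-1/beta) A], where [A] is the union of
    the regions [<p i, x> < a i].  Near the origin the density of [C] looks like
    the homogeneous function [h], and a homogeneous density scales as
    [nu (t A) = t^beta nu A]; so each copy does so with probability close to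
    [nu A / K] ([density_close], [density_rate]), and by independence the
    probability that no copy does tends to [exp (- nu A)] ([survival_cvg]).
    Two properties of [h] are used here and have to be extracted from the
    existence of the limit.  First [beta > 0] ([exponent_gt0]): some cone on which
    [h >= e |x|_1^alpha] has positive measure, the integrability of the density
    of [C] makes the part of that cone near the origin [nu]-finite, and the
    [nu]-mass of this part scales with exponent [beta] while it decreases to
    zero.  Next, [nu] is finite on bounded sets ([homogeneous_ball_fin]): up to
    an integrable error [h] is at most [|x|_1^alpha] near the origin, which is
    integrable there because its integrals over dyadic shells form a geometric
    series.

    The limit is the survival function of a probability law ([exists_limit_law]):
    it is that of the coordinatewise minimum of the points [(<p i, x>)_i] where
    [x] runs through a Poisson process of intensity [nu].  For a finite intensity
    that law is an explicit mixture over the number of points ([poisson_min]).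
    Here the intensity is infinite, but points with large coordinates do not
    affect the minimum inside a given box, so the laws obtained by truncation
    agree on larger and larger boxes and can be glued ([exists_glued_law]).

    Weak convergence ([upper_box_cvg_in_distribution]) follows from the
    convergence of survival functions: half-open boxes are reached by successive
    differences of upper boxes, a nonnegative continuous function is the limit of
    step functions on half-open cells that lie below it, and a lower bound for
    the limit of the integrals of [M + f] and of [M - f] gives convergence for a
    bounded continuous [f].

    For one point, the survival function is [exp (- lambda a^beta)].  Continuous
    functions between two indicators of rays show that any weak limit has this
    tail ([cvg_in_distribution_weibull]), so that its power [beta] has an
    exponential tail, and rays determine a law ([exponential_law]). *)

(** * Image measures and scaling of Lebesgue measure *)

Lemma measurable_preimage (d d' : measure_display) (T : measurableType d)
    (U : measurableType d') (f : T -> U) (A : set U) :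
  measurable_fun setT f -> measurable A -> measurable (f @^-1` A).
Proof. by move=> mf mA; rewrite -[X in measurable X]setTI; exact: mf. Qed.

Section measurable_rays.
Context (d : measure_display) (T : measurableType d) (R : realType).
Variables (f : T -> R) (a : R).
Hypothesis mf : measurable_fun [set: T] f.

Lemma measurable_lt : measurable [set x | f x < a].
Proof.
rewrite (_ : [set _ | _] = f @^-1` `]-oo, a[); first exact: measurable_preimage.
by apply/seteqP; split=> x; rewrite /= in_itv.
Qed.

Lemma measurable_gt : measurable [set x | a < f x].
Proof.
rewrite (_ : [set _ | _] = f @^-1` `]a, +oo[); first exact: measurable_preimage.
by apply/seteqP; split=> x; rewrite /= in_itv/= andbT.
Qed.

Lemma measurable_ge : measurable [set x | a <= f x].
Proof.
rewrite (_ : [set _ | _] = f @^-1` `[a, +oo[); first exact: measurable_preimage.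
by apply/seteqP; split=> x; rewrite /= in_itv/= andbT.
Qed.

End measurable_rays.

(** [pushforward] bundled with its measure structure: unification cannot recover
    the measurability of [f] from [pushforward m f] alone. *)
Definition image_measure (d d' : measure_display) (T : measurableType d)
    (U : measurableType d') (R : realType) (m : {measure set T -> \bar R})
    (f : T -> U) (mf : measurable_fun [set: T] f) :
    {measure set U -> \bar R} :=
  measure_function_pushforward__canonical__measure_function_Measure m mf.

Section scaling.
Context {R : realType}.
Implicit Types b : R.

Lemma lebesgue_measure_scale b (A : set R) : 0 < b -> measurable A ->
  lebesgue_measure ( *%R b @^-1` A) = (b^-1%:E * lebesgue_measure A)%E.
Proof.
move=> b0 mA.
pose f : measurableTypeR R -> measurableTypeR R := *%R b.
have mf : measurable_fun setT f by exact: measurable_funM.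
pose m := mscale (NngNum (ltW b0)) (image_measure lebesgue_measure mf).
have -> : lebesgue_measure A = m A.
  apply: lebesgue_measure_unique => // _ [[x y]] _ <-.
  rewrite /m/= /mscale/= /pushforward.
  rewrite (_ : _ @^-1` _ = `]b^-1 * x, b^-1 * y]%classic); last first.
    apply/seteqP; split=> z /=; rewrite !in_itv/= ltr_pdivrMl// ler_pdivlMl//.
  rewrite !lebesgue_measure_itv/= !lte_fin ltr_pM2l ?invr_gt0//.
  case: ifPn => _; last by rewrite mule0.
  by rewrite -!EFinB -EFinM -mulrBr mulrA divff ?mul1r// gt_eqF.
by rewrite /m/= /mscale/= /pushforward muleA -EFinM mulVf ?mul1e// gt_eqF.
Qed.

Lemma measurable_scale n b :
  measurable_fun [set: 'rV[R]_n] (fun x : 'rV[R]_n => b *: x).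
Proof.
apply: measurable_fun_rVP => i; under eq_fun do rewrite mxE.
by apply: measurable_funM => //; exact: measurable_coord.
Qed.

(** The section at [x] of the dilated set is a dilate of the section at [b x];
    the induction hypothesis contributes [b^-n] on each section, and the change
    of variable in the first coordinate the remaining [b^-1]. *)
Lemma lebesgue_rV_scale n b (A : set 'rV[R]_n) : 0 < b -> measurable A ->
  lebesgue_rV n ((fun x => b *: x) @^-1` A) =
  ((b ^- n)%:E * lebesgue_rV n A)%E.
Proof.
move=> b0; elim: n A => [|n IHn] A mA.
  rewrite /= expr0 invr1 mul1e !diracE; congr ((nat_of_bool _)%:R%:E).
  by apply/idP/idP; rewrite !inE/= scaler0.
rewrite /= /lebesgue_cons/pushforward.
have mA' : measurable (@consrV R n @^-1` A : set (measurableTypeR R * 'rV[R]_n)).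
  by apply: measurable_preimage => //; exact: measurable_consrV.
rewrite /product_measure1.
pose g (x : measurableTypeR R) : \bar R :=
  lebesgue_rV n (xsection (@consrV R n @^-1` A) x).
have mg : measurable_fun setT g by exact: measurable_fun_xsection.
pose f : measurableTypeR R -> measurableTypeR R := *%R b.
have mf : measurable_fun setT f by exact: measurable_funM.
transitivity (\int[@lebesgue_measure R]_x ((b ^- n)%:E * (g (f x))))%E.
  apply: eq_integral => x _ /=; rewrite /g -IHn; last exact: measurable_xsection.
  congr (lebesgue_rV n _); apply/seteqP; split => y /=;
    rewrite /xsection/= !inE/=;
    rewrite (_ : b *: consrV (x, y) = consrV (f x, b *: y))//;
    apply/rowP => i; rewrite mxE;
    by have [j ->|->] := unliftP ord0 i; rewrite ?consrVS ?consrV0 ?mxE.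
rewrite ge0_integralZl//; last 2 first.
  - exact: measurableT_comp.
  - by rewrite lee_fin invr_ge0 exprn_ge0// ltW.
rewrite exprS invfM mulrC EFinM -muleA; congr (_ * _)%E.
pose m := image_measure lebesgue_measure mf.
transitivity (\int[m]_x g x)%E.
  by rewrite ge0_integral_pushforward.
have b0' : 0 <= b^-1 by rewrite invr_ge0 ltW.
rewrite (@eq_measure_integral _ _ _ _ (mscale (NngNum b0') lebesgue_measure));
  last by move=> B mB _ /=; rewrite /m /pushforward lebesgue_measure_scale.
by rewrite ge0_integral_mscale.
Qed.

End scaling.

(** * Measures with a density *)

Section density.
Local Open Scope ereal_scope.
Context (d : measure_display) (T : measurableType d) (R : realType).
Variables (m : {measure set T -> \bar R}) (D : set T) (f : T -> R).
Hypotheses (mD : measurable D) (mf : measurable_fun D f).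
Hypothesis f0 : forall x, D x -> (0 <= f x)%R.

Definition density : set T -> \bar R :=
  fun A => \int[m]_(x in A `&` D) (f x)%:E.

Let density0 : density set0 = 0.
Proof. by rewrite /density set0I integral_set0. Qed.

Let density_ge0 A : 0 <= density A.
Proof. by apply: integral_ge0 => x [_ Dx]; rewrite lee_fin f0. Qed.

Let density_sigma_additive : semi_sigma_additive density.
Proof.
move=> F mF tF mUF.
have -> : density (\bigcup_k F k) = \sum_(k <oo) density (F k).
  rewrite /density setI_bigcupl ge0_integral_bigcup//.
  - by move=> k; exact: measurableI.
  - apply/measurable_EFinP; apply: measurable_funS mf => //.
    by move=> x [k _ []].
  - by move=> x [k _ [_ Dx]]; rewrite lee_fin f0.
  - exact: trivIset_setIr.
exact: is_cvg_nneseries.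
Qed.

HB.instance Definition _ := isMeasure.Build _ _ _ density
  density0 density_ge0 density_sigma_additive.

Definition density_measure : {measure set T -> \bar R} := density.

Lemma density_measureE A :
  density_measure A = \int[m]_(x in A `&` D) (f x)%:E.
Proof. by []. Qed.

End density.

(** * Homogeneous densities on the orthant *)

Section orthant_sets.
Context {R : realType} {n : nat}.
Implicit Types (x p : 'rV[R]_n) (b a : R).

Definition l1 x : R := \sum_i x 0 i.

Lemma measurable_box (A : 'I_n -> set R) : (forall i, measurable (A i)) ->
  measurable [set x : 'rV[R]_n | forall i, A i (x 0 i)].
Proof.
move=> mA; rewrite (_ : [set _ | _] = \bigcap_(i in [set: 'I_n])
    ((fun x : 'rV[R]_n => x 0 i) @^-1` A i)).
  apply: fin_bigcap_measurable => // i _.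
  by apply: measurable_preimage => //; exact: measurable_coord.
by apply/seteqP; split=> [x xA i _|x xA i]; exact: xA.
Qed.

Lemma measurable_dotr p : measurable_fun setT (dotr p).
Proof.
apply: measurable_sum => i.
by apply: measurable_funM => //; exact: measurable_coord.
Qed.

Lemma measurable_l1 : measurable_fun setT l1.
Proof. by apply: measurable_sum => i; exact: measurable_coord. Qed.

Lemma measurable_orthant : measurable (@orthant R n).
Proof.
rewrite (_ : @orthant R n = [set x | forall i, `]0, +oo[%classic (x 0 i)]).
  by apply: (measurable_box (A := fun=> _)) => i; exact: measurable_itv.
by apply/seteqP; split=> x xo i; have := xo i; rewrite /= in_itv/= andbT.
Qed.

Lemma measurable_region p a : measurable (region p a).
Proof.
have /(measurableI _ _ measurable_orthant) : measurable [set x | dotr p x < a].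
  by apply: measurable_lt; exact: measurable_dotr.
exact.
Qed.

Lemma measurable_region_union r (p : 'I_r -> 'rV[R]_n) (a : 'I_r -> R) :
  measurable (region_union p a).
Proof.
apply: fin_bigcup_measurable; first exact: finite_finset.
by move=> i _; exact: measurable_region.
Qed.

Lemma dotrC p x : dotr p x = dotr x p.
Proof. by apply: eq_bigr => i _; rewrite mulrC. Qed.

Lemma dotrZ p b x : dotr p (b *: x) = b * dotr p x.
Proof. by rewrite mulr_sumr; apply: eq_bigr => i _; rewrite mxE mulrCA. Qed.

Lemma l1Z b x : l1 (b *: x) = b * l1 x.
Proof. by rewrite mulr_sumr; apply: eq_bigr => i _; rewrite mxE. Qed.

Lemma orthantZ b x : 0 < b -> orthant (b *: x) <-> orthant x.
Proof. by move=> b0; split=> xo i; have := xo i; rewrite mxE pmulr_rgt0. Qed.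

Lemma region_unionZ r (p : 'I_r -> 'rV[R]_n) (a : 'I_r -> R) b : 0 < b ->
  (fun x => b *: x) @^-1` region_union p a =
  region_union p (fun i => b^-1 * a i).
Proof.
move=> b0; apply/seteqP; split=> x /= [i _ [xo]] pxa; exists i => //.
  split; first exact/(orthantZ _ b0).
  by rewrite ltr_pdivlMl// -dotrZ.
split; first exact/(orthantZ _ b0).
by rewrite dotrZ -ltr_pdivlMl.
Qed.

End orthant_sets.

Lemma powRD_gt0 (R : realType) (b x y : R) : 0 < b ->
  b `^ (x + y) = b `^ x * b `^ y.
Proof. by move=> b0; rewrite powRD// (gt_eqF b0) implybT. Qed.

Section homogeneous.
Context {R : realType} {n : nat} (alpha : R).

Definition homogeneous (f : 'rV[R]_n -> R) :=
  forall b x, 0 < b -> orthant x -> f (b *: x) = b `^ alpha * f x.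

Variable f : 'rV[R]_n -> R.
Hypotheses (mf : nonneg_measurable f).

Definition orthant_measure : {measure set 'rV[R]_n -> \bar R} :=
  density_measure (lebesgue_rV n) measurable_orthant mf.1 mf.2.

Lemma orthant_measure_sub (A : set 'rV[R]_n) : A `<=` @orthant R n ->
  orthant_measure A = (\int[lebesgue_rV n]_(x in A) (f x)%:E)%E.
Proof. by move=> Ao; rewrite [LHS]density_measureE setIidl. Qed.

Hypothesis hf : homogeneous f.

(** Dilating a set by [b^-1] multiplies its measure by [b^-n], from Lebesgue
    measure, and by [b^-alpha], from the density. *)
Lemma orthant_measure_scale (b : R) (A : set 'rV[R]_n) :
  0 < b -> measurable A ->
  orthant_measure ((fun x => b *: x) @^-1` A) =
  ((b `^ (- (n%:R + alpha)))%:E * orthant_measure A)%E.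
Proof.
move=> b0 mA; rewrite [orthant_measure _]density_measureE.
have mAo : measurable (A `&` @orthant R n).
  by apply: measurableI => //; exact: measurable_orthant.
have mfA : measurable_fun (A `&` @orthant R n) (EFin \o f).
  by apply/measurable_EFinP; apply: measurable_funS mf.1 => //;
    exact: measurable_orthant.
have f0 x : (A `&` @orthant R n) x -> (0 <= (EFin \o f) x)%E.
  by move=> [_ xo]; rewrite lee_fin mf.2.
pose g (x : 'rV[R]_n) := b *: x.
have mg : measurable_fun setT g by exact: measurable_scale.
have -> : g @^-1` A `&` @orthant R n = g @^-1` (A `&` @orthant R n).
  by apply/seteqP; split=> x [gxA xo]; split=> //; exact/(orthantZ _ b0).
transitivity (\int[lebesgue_rV n]_(x in g @^-1` (A `&` @orthant R n))
    ((b `^ (- alpha))%:E * ((EFin \o f) \o g) x))%E.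
  apply: eq_integral => x /[!inE] -[_ xo] /=.
  rewrite -EFinM hf//; last exact/(orthantZ _ b0).
  by rewrite powRN mulrA mulVf ?mul1r// gt_eqF// powR_gt0.
rewrite ge0_integralZl//; last 4 first.
- exact: measurable_preimage.
- have mgo := measurable_preimage mg mAo.
  have h : measurable_fun (g @^-1` (A `&` @orthant R n)) g by exact: measurable_funTS.
  apply: (measurable_comp mAo _ mfA h).
  by move=> _ [x + <-].
- by move=> x /= [_ xo]; rewrite lee_fin mf.2.
- by rewrite lee_fin powR_ge0.
rewrite -ge0_integral_pushforward//; last by move=> y /[!inE]; exact: f0.
rewrite [X in (_ * X)%E](_ : _ =
    \int[image_measure (lebesgue_rV n) mg]_(y in A `&` @orthant R n) (f y)%:E)%E//.
have bn0 : 0 <= b ^- n by rewrite invr_ge0 exprn_ge0// ltW.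
rewrite (@eq_measure_integral _ _ _ _ (mscale (NngNum bn0) (lebesgue_rV n)));
  last by move=> B mB _ /=; rewrite /pushforward lebesgue_rV_scale.
rewrite ge0_integral_mscale// muleA -EFinM/=.
congr (_%:E * _)%E; rewrite -powR_invn ?ltW//.
by rewrite opprD addrC powRD_gt0.
Qed.

End homogeneous.

(** * Asymptotic homogeneity at the origin *)

Section orthant_measure_comparison.
Context {R : realType} {n : nat}.
Local Open Scope ereal_scope.

Lemma orthant_measure_le (f g k : 'rV[R]_n -> R) (mf : nonneg_measurable f)
    (mg : nonneg_measurable g) (mk : nonneg_measurable k) (c e : R) A :
  (0 <= c)%R -> (0 <= e)%R -> measurable A ->
  (forall x, A x -> orthant x -> (f x <= c * g x + e * k x)%R) ->
  orthant_measure mf A <=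
    c%:E * orthant_measure mg A + e%:E * orthant_measure mk A.
Proof.
move=> c0 e0 mA fgk.
have mAo : measurable (A `&` @orthant R n).
  by apply: measurableI => //; exact: measurable_orthant.
have mE (u : 'rV[R]_n -> R) : nonneg_measurable u ->
    measurable_fun (A `&` @orthant R n) (EFin \o u).
  move=> [mu _]; apply/measurable_EFinP; apply: measurable_funS mu => //.
  exact: measurable_orthant.
have E0 (u : 'rV[R]_n -> R) : nonneg_measurable u ->
    forall x, (A `&` @orthant R n) x -> 0 <= (EFin \o u) x.
  by move=> [_ u0] x [_ xo]; rewrite lee_fin u0.
rewrite !density_measureE -!ge0_integralZl//; try solve
  [by rewrite lee_fin | exact: mE | exact: E0].
have E0' (u : 'rV[R]_n -> R) (a : R) : (0 <= a)%R -> nonneg_measurable u ->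
    forall x, (A `&` @orthant R n) x -> 0 <= a%:E * (u x)%:E.
  by move=> a0 mu x xA; rewrite mule_ge0//; exact: E0.
have mE' (u : 'rV[R]_n -> R) (a : R) : nonneg_measurable u ->
    measurable_fun (A `&` @orthant R n) (fun x => a%:E * (u x)%:E).
  by move=> mu; apply: measurable_funeM; exact: mE.
rewrite -ge0_integralD//; try solve [exact: mE' | exact: E0'].
apply: ge0_le_integral => //.
- exact: E0.
- exact: mE.
- by apply: emeasurable_funD; exact: mE'.
- by move=> x [xA xo]; rewrite -!EFinM -EFinD lee_fin fgk.
Qed.

End orthant_measure_comparison.

Section l1_power.
Context {R : realType} {n : nat} (hn : (2 <= n)%N) (alpha : R).
Implicit Types x : 'rV[R]_n.

Lemma l1_gt0 x : orthant x -> 0 < l1 x.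
Proof.
case: n hn x => // m _ x xo; rewrite /l1 big_ord_recl ltr_wpDr//.
by apply: sumr_ge0 => i _; exact/ltW.
Qed.

Lemma coord_lt_l1 x i : orthant x -> x 0 i < l1 x.
Proof.
case: n hn x i => [//|[//|m]] _ x i xo; rewrite /l1 (bigD1 i)//= ltrDl.
have [j ji] : exists j, j != i.
  by exists (lift i ord0); rewrite eq_sym; exact: neq_lift.
rewrite (bigD1 j)//= ltr_wpDr//.
by apply: sumr_ge0 => k _; exact/ltW.
Qed.

(** The coordinates are less than [1] because [n >= 2]; for [n = 1] the open
    simplex is empty. *)
Lemma simplex_l1 x : orthant x -> simplex ((l1 x)^-1 *: x).
Proof.
move=> xo; have s0 := l1_gt0 xo; split=> [i|].
  rewrite mxE mulr_gt0 ?invr_gt0//= mulrC ltr_pdivrMr// mul1r.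
  exact: coord_lt_l1.
by rewrite -/(l1 _) l1Z mulVf// gt_eqF.
Qed.

Definition l1_power x := l1 x `^ alpha.

Lemma nonneg_l1_power : nonneg_measurable l1_power.
Proof.
split=> [|x _]; last by rewrite /l1_power powR_ge0.
apply: measurable_funTS.
exact: (measurableT_comp (measurable_powR alpha) measurable_l1).
Qed.

Lemma homogeneous_l1_power : homogeneous alpha l1_power.
Proof.
by move=> b x b0 xo; rewrite /l1_power l1Z powRM// ltW// l1_gt0.
Qed.

Definition l1_ball (t : R) : set 'rV[R]_n := [set x | l1 x < t].

Lemma measurable_l1_ball t : measurable (l1_ball t).
Proof. by apply: measurable_lt; exact: measurable_l1. Qed.

Lemma l1_ballZ b t : 0 < b ->
  (fun x => b *: x) @^-1` l1_ball t = l1_ball (b^-1 * t).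
Proof.
by move=> b0; apply/seteqP; split=> x; rewrite /l1_ball/= l1Z ltr_pdivlMl.
Qed.

End l1_power.

Section asymptotics.
Context {R : realType} {n : nat} (hn : (2 <= n)%N) (alpha : R).
Variables (rho h : 'rV[R]_n -> R).
Hypothesis rho_lim : forall x, orthant x ->
  kappa `^ (- alpha) * rho (kappa *: x) @[kappa --> 0^'+] --> h x.
Hypothesis rho_unif : {uniform @simplex R n,
  (fun x => kappa `^ (- alpha) * rho (kappa *: x)) @[kappa --> 0^'+] --> h}.

Lemma limit_homogeneous : homogeneous alpha h.
Proof.
move=> b x b0 xo.
(* the defining limit at [b *: x] is, with [kappa * b] for [kappa], a multiple
   of the one at [x] *)
apply: (@cvg_unique _ _
  (kappa `^ (- alpha) * rho (kappa *: (b *: x)) @[kappa --> 0^'+])).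
- exact: norm_hausdorff.
- by apply: rho_lim; exact/orthantZ.
have bcvg : kappa * b @[kappa --> (0:R)^'+] --> (0:R)^'+.
  move=> A [e /= e0 eA]; change (\forall k \near (0:R)^'+, A (k * b)); near=> k.
  have kb0 : 0 < k * b by rewrite mulr_gt0//; near: k; exact: nbhs_right_gt.
  apply: eA => //=; rewrite sub0r normrN gtr0_norm// -ltr_pdivlMr//.
  by near: k; apply: nbhs_right_lt; rewrite divr_gt0.
have c : b `^ alpha * ((k * b) `^ (- alpha) * rho ((k * b) *: x))
    @[k --> (0:R)^'+] --> b `^ alpha * h x.
  by apply: cvgMl_tmp; exact: (cvg_comp _ _ bcvg (rho_lim xo)).
apply: cvg_trans c; apply: near_eq_cvg; near=> k => /=.
have k0 : 0 < k by near: k; exact: nbhs_right_gt.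
rewrite scalerA powRM ?ltW// mulrA; congr (_ * _).
by rewrite mulrCA -powRD_gt0// subrr powRr0 mulr1.
Unshelve. all: by end_near. Qed.

(** A point [x] of the orthant is [l1 x] times a point of the simplex, so uniform
    convergence on the simplex, read at [kappa = l1 x], compares [rho] with [h]
    on a whole neighbourhood of the origin. *)
Lemma density_close e : 0 < e -> exists2 t, 0 < t &
  forall x, orthant x -> l1 x < t -> `|rho x - h x| <= e * l1_power alpha x.
Proof.
move=> e0.
have /rho_unif : nbhs (h : {uniform` @simplex R n -> R})
    [set g | forall x, simplex x -> `|h x - g x| < e].
  apply/uniform_nbhs; exists [set xy | ball xy.1 e xy.2]; split.
    exact: (entourage_ball _ (PosNum e0)).
  by move=> g /= hg x /hg.
move=> [t /= t0 ht]; exists t => // x xo xt.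
have s0 := l1_gt0 hn xo.
have /= := ht (l1 x); rewrite sub0r normrN gtr0_norm// => /(_ xt s0).
move=> /(_ _ (simplex_l1 hn xo)).
rewrite scalerA divff ?gt_eqF// scale1r.
rewrite limit_homogeneous ?invr_gt0//.
rewrite (_ : _^-1 `^ alpha = l1 x `^ (- alpha)); last first.
  by rewrite -powR_inv1 ?ltW// -powRrM mulN1r.
rewrite -mulrBr normrM gtr0_norm ?powR_gt0// powRN distrC.
by rewrite ltr_pdivrMl ?powR_gt0// mulrC => /ltW.
Qed.

End asymptotics.

Lemma measure_bigcup_eq0 (d : measure_display) (T : measurableType d)
    (R : realType) (m : {measure set T -> \bar R}) (F : (set T)^nat) :
  (forall k, measurable (F k)) -> (forall k, m (F k) = 0%E) ->
  m (\bigcup_k F k) = 0%E.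
Proof.
move=> mF mF0; apply/eqP; rewrite -measure_le0.
apply: (le_trans (generalized_Boole_inequality m mF _)).
  exact: bigcupT_measurable.
by rewrite eseries0.
Qed.

Lemma measurable_fun_ltr_set (d : measure_display) (T : measurableType d)
    (R : realType) (D : set T) (f g : T -> R) : measurable D ->
  measurable_fun D f -> measurable_fun D g ->
  measurable [set x | D x /\ f x < g x].
Proof.
move=> mD mf mg; have := measurable_fun_ltr mf mg mD (Y := [set true]).
rewrite (_ : _ `&` _ = [set x | D x /\ f x < g x]); first exact.
by apply/seteqP; split=> x [].
Qed.

Section exponent.
Context {R : realType} {n : nat} (hn : (2 <= n)%N) (alpha : R).
Variables (rho h : 'rV[R]_n -> R).
Hypotheses (mrho : nonneg_measurable rho) (mh : nonneg_measurable h).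
Hypothesis hh : homogeneous alpha h.
Hypothesis close : forall e, 0 < e -> exists2 t, 0 < t &
  forall x, orthant x -> l1 x < t -> `|rho x - h x| <= e * l1_power alpha x.
Hypothesis rho_fin : (orthant_measure mrho setT < +oo)%E.
Hypothesis h_pos : (0 < \int[lebesgue_rV n]_(x in @orthant R n) (h x)%:E)%E.

Let nu_h := orthant_measure mh.
Let nu_rho := orthant_measure mrho.
Let beta : R := n%:R + alpha.

Let cone (e : R) : set 'rV[R]_n :=
  [set x | orthant x /\ e * l1_power alpha x < h x].

Let measurable_cone e : measurable (cone e).
Proof.
apply: measurable_fun_ltr_set mh.1; first exact: measurable_orthant.
by apply: measurable_funM => //; exact: (@nonneg_l1_power R n alpha).1.
Qed.

Let coneZ e b x : 0 < b -> cone e (b *: x) <-> cone e x.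
Proof.
move=> b0; have bo := @orthantZ R n b x b0.
split=> -[xo ex].
- have xo' : orthant x by apply/bo.
  split=> //; move: ex; rewrite hh// (homogeneous_l1_power hn)// mulrCA.
  by rewrite ltr_pM2l ?powR_gt0.
- split=> //; first exact/bo.
  rewrite hh// (homogeneous_l1_power hn)// mulrCA.
  by rewrite ltr_pM2l ?powR_gt0.
Qed.

(** The cones increase to [h > 0] as [e] decreases to [0], and [h > 0] carries
    all the mass of [h]. *)
Let cone_pos : exists2 e, 0 < e & nu_h (cone e) != 0%E.
Proof.
apply: contrapT => cone0.
have cup0 : nu_h (\bigcup_k cone k.+1%:R^-1) = 0%E.
  apply: measure_bigcup_eq0 => // k; apply/eqP/negPn/negP => ?.
  by apply: cone0; exists k.+1%:R^-1; rewrite ?invr_gt0.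
have mcup : measurable (\bigcup_k cone k.+1%:R^-1) by exact: bigcupT_measurable.
have cupC0 : nu_h (~` \bigcup_k cone k.+1%:R^-1) = 0%E.
  rewrite [nu_h _]density_measureE integral0_eq// => x [ncone xo].
  apply/eqP; rewrite eqe eq_le mh.2// andbT leNgt; apply/negP => hx.
  apply: ncone; pose s := l1_power alpha x / h x.
  exists (Num.truncn s) => //; split=> //.
  by rewrite mulrC ltr_pdivrMr// mulrC -ltr_pdivrMr// truncnS_gt.
move: h_pos; rewrite -(orthant_measure_sub mh (@subset_refl _ _)) -/nu_h.
rewrite measure_gt0 => /negP; apply; rewrite -measure_le0.
set U := \bigcup_k _ in mcup cup0 cupC0.
apply: (@le_trans _ _ (nu_h U + nu_h (~` U))%E); last by rewrite cup0 cupC0 adde0.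
have mUC := measurableC mcup.
apply: le_trans (measureU2 nu_h mcup mUC).
by rewrite setUv le_measure// inE//; exact: measurable_orthant.
Qed.

(** On a cone where [e |x|_1^alpha < h x], the bound
    [|rho - h| <= e / 2 |x|_1^alpha] gives [h <= 2 rho] near the origin, so the truncated cone [D 1] has finite
    mass, which is positive.  Its dilates [D b] have mass [b^-beta] times as
    large and decrease to the empty set; for [beta <= 0] their masses could not
    tend to [0]. *)
Lemma exponent_gt0 : 0 < beta.
Proof.
have [e e0 De] := cone_pos.
have /close[t t0 ht] : 0 < e / 2 by rewrite divr_gt0.
pose D b := cone e `&` l1_ball (b^-1 * t).
have mD b : measurable (D b).
  by apply: measurableI => //; exact: measurable_l1_ball.
have DZ b : 0 < b -> nu_h (D b) = ((b `^ - beta)%:E * nu_h (D 1%R))%E.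
  move=> b0; rewrite -(orthant_measure_scale mh hh)//.
  congr (nu_h _); rewrite /D preimage_setI invr1 mul1r (l1_ballZ _ b0).
  by congr (_ `&` _); apply/seteqP; split=> x /=; rewrite coneZ.
have D1fin : (nu_h (D 1%R) < +oo)%E.
  apply: (@le_lt_trans _ _ (2%:E * nu_rho (D 1%R) + 0%:E * nu_h (D 1%R)))%E.
    apply: orthant_measure_le => // x [[xo ex]]; rewrite /l1_ball/= invr1 mul1r.
    move=> /(ht _ xo); rewrite ler_norml => /andP[+ _] _.
    by rewrite mul0r addr0; lra.
  rewrite mul0e adde0 lte_mul_pinfty//.
  by apply: le_lt_trans rho_fin; rewrite le_measure// inE//; exact: mD.
have D1pos : (0 < nu_h (D 1%R))%E.
  rewrite measure_gt0; apply: contra De => /eqP D10.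
  rewrite (_ : cone e = \bigcup_k D k.+1%:R^-1).
    rewrite measure_bigcup_eq0// => k; rewrite DZ ?invr_gt0//.
    by rewrite D10 mule0.
  apply/seteqP; split=> [x xe|x [k _ []]//].
  exists (Num.truncn (l1 x / t)) => //; split=> //.
  by rewrite /l1_ball/= invrK -ltr_pdivrMr// truncnS_gt.
rewrite ltNge; apply/negP => beta0.
have : (nu_h \o (fun k => D k.+1%:R)) k @[k --> \oo] -->
    nu_h (\bigcap_k D k.+1%:R).
  apply: nonincreasing_cvg_mu => //.
    exact: bigcapT_measurable.
  move=> i j ij; apply/subsetPset => x [xe xt]; split=> //.
  apply: lt_le_trans xt _; rewrite ler_pM2r// lef_pV2 ?posrE//.
  by rewrite ler_nat.
have -> : \bigcap_k D k.+1%:R = set0.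
  rewrite -subset0 => x xD; have [[xo _] _] := xD 0%N I.
  have s0 := l1_gt0 hn xo.
  have [_] := xD (Num.truncn (t / l1 x)) I.
  rewrite /l1_ball/= mulrC ltr_pdivlMr// mulrC -ltr_pdivlMr// ltNge.
  by rewrite ltW// truncnS_gt.
rewrite measure0 => /(@cvge_to_ge _ _ _ _ _ (nu_h (D 1%R))) D1le.
suff : (nu_h (D 1%R) <= 0)%E by rewrite leNgt D1pos.
apply: D1le; apply: nearW => k; rewrite [leRHS]/= (DZ k.+1%:R)//.
rewrite -[leLHS]mul1e; apply: lee_wpmul2r => //; rewrite lee_fin.
have k1 : 1 <= k.+1%:R :> R by rewrite ler1n.
by rewrite -[leLHS](powRr0 k.+1%:R) ler_powR// oppr_ge0.
Qed.

End exponent.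

Section finiteness.
Context {R : realType} {n : nat} (hn : (2 <= n)%N) (alpha : R).
Hypothesis beta0 : 0 < n%:R + alpha.

Let nu_s := orthant_measure (@nonneg_l1_power R n alpha).
Let q : R := 2 `^ (- (n%:R + alpha)).

Let shell (k : nat) : set 'rV[R]_n :=
  [set x | orthant x /\ 2 ^- k.+1 <= l1 x < 2 ^- k].

Let shellE k : shell k = (fun x => 2 ^+ k *: x) @^-1` shell 0%N.
Proof.
have k0 : (0 : R) < 2 ^+ k by rewrite exprn_gt0.
apply/seteqP; split=> x; rewrite /shell/= l1Z expr1 expr0 invr1 exprS invfM.
  move=> [xo /andP[x1 x2]]; split; first exact/(orthantZ _ k0).
  by rewrite mulrC -ler_pdivrMr// x1/= -ltr_pdivlMr// div1r.
move=> [/(orthantZ _ k0) xo /andP[x1 x2]]; split=> //.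
by rewrite ler_pdivrMr// mulrC x1/= -div1r ltr_pdivlMr// mulrC.
Qed.

Let measurable_shell0 : measurable (shell 0%N).
Proof.
rewrite (_ : shell 0%N =
    @orthant R n `&` @l1 R n @^-1` `[2 ^- 1, 2 ^- 0[); last first.
  by apply/seteqP; split=> x []; rewrite /= in_itv.
apply: measurableI; first exact: measurable_orthant.
by apply: measurable_preimage => //; exact: measurable_l1.
Qed.

Let measurable_shell k : measurable (shell k).
Proof.
by rewrite shellE; apply: measurable_preimage => //; exact: measurable_scale.
Qed.

Let nu_shell k : nu_s (shell k) = ((q ^+ k)%:E * nu_s (shell 0%N))%E.
Proof.
rewrite [in LHS]shellE.
rewrite (orthant_measure_scale _ (homogeneous_l1_power hn _)) ?exprn_gt0//.
congr ((_)%:E * _)%E.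
by rewrite -powR_mulrn// powRAC powR_mulrn// powR_ge0.
Qed.

(** The shell lies in the unit cube and [l1] is bounded away from [0] and [+oo]
    on it. *)
Let nu_shell0_fin : (nu_s (shell 0%N) < +oo)%E.
Proof.
have [M M0 hM] : exists2 M, 0 <= M & forall s, 2^-1 <= s < 1 -> s `^ alpha <= M :> R.
  exists (2^-1 `^ alpha + 1) => [|s /andP[s1 s2]].
    by rewrite addr_ge0// powR_ge0.
  have s0 : 0 < s by apply: lt_le_trans s1.
  have [a0|a0] := leP 0 alpha.
    rewrite ler_wpDl ?powR_ge0// (_ : 1 = 1 `^ alpha); last by rewrite powR1.
    by rewrite ge0_ler_powR// ?nnegrE// ltW.
  rewrite ler_wpDr// -(opprK alpha) !(powRN _ (- alpha)) lef_pV2 ?posrE ?powR_gt0//.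
  by rewrite ge0_ler_powR// ?nnegrE ?oppr_ge0// ltW.
have shell0 : shell 0%N `<=` @orthant R n by move=> x [].
rewrite /nu_s orthant_measure_sub//.
apply: (@le_lt_trans _ _ (\int[lebesgue_rV n]_(x in shell 0%N) M%:E)%E).
  apply: ge0_le_integral => //.
  - by move=> x xs; rewrite lee_fin powR_ge0.
  - apply/measurable_EFinP; apply: measurable_funS (nonneg_l1_power alpha).1 => //.
    exact: measurable_orthant.
  - by move=> x [xo]; rewrite expr1 expr0 invr1 => xs; rewrite lee_fin hM.
rewrite integral_cst// lte_mul_pinfty//.
apply: (@le_lt_trans _ _ (lebesgue_rV n [set x | forall i, `[0, 1]%classic (x 0 i)])).
  rewrite le_measure// ?inE//; last first.
  - move=> x [xo]; rewrite expr1 expr0 invr1 => /andP[_ xs] i.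
    by rewrite /= in_itv/= ltW ?xo// (le_trans (ltW (coord_lt_l1 hn i xo)))// ltW.
  - by apply: (measurable_box (A := fun=> _)) => i; exact: measurable_itv.
rewrite (@lebesgue_rV_box _ n (fun=> `[0, 1]%classic)) => [|i]; last first.
  exact: measurable_itv.
rewrite big1 ?ltry// => i _.
by rewrite lebesgue_measure_itv/= lte_fin ltr01 oppr0 adde0.
Qed.

(** The dyadic shells cover the unit ball and their masses form a geometric
    series of ratio [2^-beta < 1]. *)
Lemma l1_power_ball_fin t : (nu_s (l1_ball t) < +oo)%E.
Proof.
have q0 : 0 <= q by rewrite powR_ge0.
have q1 : `|q| < 1.
  rewrite ger0_norm// /q powRN invf_lt1 ?powR_gt0//.
  have := gt0_ltr_powR beta0 (x := 1) (y := 2); rewrite !nnegrE powR1.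
  by apply; rewrite ?ltr1n.
have ball1 : (nu_s (l1_ball 1) < +oo)%E.
  apply: (@le_lt_trans _ _ (\sum_(k <oo) nu_s (shell k))%E).
    rewrite (_ : nu_s _ = nu_s (l1_ball 1 `&` @orthant R n)); last first.
      by rewrite /nu_s !density_measureE -setIA setIid.
    apply: measure_sigma_subadditive => //.
      by apply: measurableI; [exact: measurable_l1_ball|exact: measurable_orthant].
    move=> x [+ xo]; rewrite {1}/l1_ball/= => x1; have s0 := l1_gt0 hn xo.
    have exP : exists m, 2 ^- m <= l1 x.
      exists (Num.truncn (l1 x)^-1).+1; rewrite -[leRHS]invrK lef_pV2 ?posrE//.
      - rewrite (le_trans (ltW (truncnS_gt _)))// -natrX ler_nat.
        by rewrite ltnW// ltn_expl.
      - by rewrite invr_gt0.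
    (* the shell containing [x] is given by the least [k] with [2^-k <= l1 x];
       that [k] is positive since [l1 x < 1] *)
    case: (ex_minnP exP) => -[|k] kx kmin.
      by move: kx; rewrite expr0 invr1 leNgt x1.
    exists k => //; split=> //; rewrite kx/= ltNge.
    by apply/negP => /kmin; rewrite ltnn.
  have fE k : nu_s (shell k) = (fine (nu_s (shell 0%N)) * q ^+ k)%:E.
    by rewrite nu_shell muleC EFinM fineK// ge0_fin_numE.
  under eq_eseriesr do rewrite fE.
  set c := fine _; have c0 : 0 <= c by rewrite fine_ge0.
  apply: (@le_lt_trans _ _ (c / (1 - q))%:E); last exact: ltry.
  apply: lime_le.
    by apply: is_cvg_nneseries => k *; rewrite lee_fin mulr_ge0 ?exprn_ge0.
  apply: nearW => N; rewrite sumEFin lee_fin.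
  rewrite (_ : \sum_(_ <= _ < _) _ = series (geometric c q) N)//.
  have q1' : q < 1 by rewrite (le_lt_trans _ q1)// ler_norm.
  rewrite geometric_seriesE ?lt_eqF//= ler_pM2r ?invr_gt0 ?subr_gt0//.
  by rewrite ler_piMr// gerBl exprn_ge0.
have [t0|t0] := leP t 0.
  apply: le_lt_trans ball1; rewrite le_measure// ?inE; try exact: measurable_l1_ball.
  by move=> x; rewrite /l1_ball/= => xt; rewrite (lt_trans xt)// (le_lt_trans t0).
rewrite (_ : l1_ball t = (fun x => t^-1 *: x) @^-1` l1_ball 1); last first.
  by rewrite l1_ballZ ?invr_gt0// invrK mulr1.
rewrite (orthant_measure_scale _ (homogeneous_l1_power hn _)) ?invr_gt0//; last first.
  exact: measurable_l1_ball.
by rewrite lte_mul_pinfty// lee_fin powR_ge0.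
Qed.

End finiteness.

Section rate.
Context {R : realType} {n : nat} (hn : (2 <= n)%N) (alpha : R).
Variables (rho h : 'rV[R]_n -> R).
Hypotheses (mrho : nonneg_measurable rho) (mh : nonneg_measurable h).
Hypothesis hh : homogeneous alpha h.
Hypothesis close : forall e, 0 < e -> exists2 t, 0 < t &
  forall x, orthant x -> l1 x < t -> `|rho x - h x| <= e * l1_power alpha x.
Hypothesis rho_fin : (orthant_measure mrho setT < +oo)%E.
Hypothesis h_pos : (0 < \int[lebesgue_rV n]_(x in @orthant R n) (h x)%:E)%E.

Let nu_h := orthant_measure mh.
Let nu_rho := orthant_measure mrho.
Let nu_s := orthant_measure (@nonneg_l1_power R n alpha).
Let beta : R := n%:R + alpha.
Let beta0 : 0 < beta := exponent_gt0 hn mh hh close rho_fin h_pos.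

(** Near the origin [h <= rho + |x|_1^alpha], and both terms are integrable; the
    scaling of [nu_h] then reaches every ball. *)
Lemma homogeneous_ball_fin t : (nu_h (l1_ball t) < +oo)%E.
Proof.
have [t1 t10 ht] := close ltr01.
have ball1 : (nu_h (l1_ball t1) < +oo)%E.
  apply: (@le_lt_trans _ _ (1%:E * nu_rho (l1_ball t1) + 1%:E * nu_s (l1_ball t1)))%E.
    apply: orthant_measure_le => //; first exact: measurable_l1_ball.
    by move=> x xt /ht/(_ xt); rewrite ler_norml => /andP[+ _]; lra.
  rewrite !mul1e lte_add_pinfty//; last exact: l1_power_ball_fin.
  apply: le_lt_trans rho_fin; rewrite le_measure// ?inE//.
  exact: measurable_l1_ball.
have [t0|t0] := leP t 0.
  apply: le_lt_trans ball1; rewrite le_measure// ?inE; try exact: measurable_l1_ball.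
  by move=> x; rewrite /l1_ball/= => xt; rewrite (lt_trans xt)// (le_lt_trans t0).
rewrite (_ : l1_ball t = (fun x => (t1 / t) *: x) @^-1` l1_ball t1); last first.
  by rewrite l1_ballZ ?divr_gt0// invf_div divfK// gt_eqF.
rewrite (orthant_measure_scale _ hh) ?divr_gt0//; last first.
  exact: measurable_l1_ball.
by rewrite lte_mul_pinfty// lee_fin powR_ge0.
Qed.

Lemma powR_root_opp (K : nat) : (0 < K)%N -> (K%:R `^ beta^-1) `^ (- beta) = K%:R^-1.
Proof.
by move=> K0; rewrite -powRrM mulrN mulVf ?gt_eqF// powR_inv1.
Qed.

(** Comparing [rho] with [h] on [K^(-1/beta) A] costs at most
    [ep * nu_s (K^(-1/beta) A) = ep * nu_s A / K], which stays negligible after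
    multiplication by [K]. *)
Lemma density_rate (A : set 'rV[R]_n) B : measurable A -> A `<=` l1_ball B ->
  (K%:R%:E * nu_rho ((fun x => K%:R `^ beta^-1 *: x) @^-1` A))%E
    @[K --> \oo] --> nu_h A.
Proof.
move=> mA AB.
have hA : (nu_h A < +oo)%E.
  apply: le_lt_trans (homogeneous_ball_fin B); rewrite le_measure// ?inE//.
  exact: measurable_l1_ball.
have sA : (nu_s A < +oo)%E.
  apply: le_lt_trans (l1_power_ball_fin hn beta0 B); rewrite le_measure// ?inE//.
  exact: measurable_l1_ball.
have rA X : measurable X -> (nu_rho X < +oo)%E.
  by move=> mX; apply: le_lt_trans rho_fin; rewrite le_measure// ?inE.
pose AK (K : nat) := (fun x => K%:R `^ beta^-1 *: x) @^-1` A.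
have mAK K : measurable (AK K).
  by apply: measurable_preimage => //; exact: measurable_scale.
have -> : nu_h A = (fine (nu_h A))%:E by rewrite fineK// ge0_fin_numE.
have -> : (fun K : nat => K%:R%:E * nu_rho (AK K))%E =
    (fun K => (K%:R * fine (nu_rho (AK K)))%:E).
  by apply/funext => K; rewrite EFinM fineK// ge0_fin_numE// rA.
apply: cvg_EFin; first exact: nearW.
apply/cvgrPdist_le => e e0.
set S := fine (nu_s A); have S0 : 0 <= S by rewrite fine_ge0.
have /close[t t0 ht] : 0 < e / (S + 1) by rewrite divr_gt0// ltr_wpDl.
set ep := e / (S + 1) in ht.
have ep0 : 0 <= ep by rewrite ltW// divr_gt0// ltr_wpDl.
near=> K => /=.
have K0 : (0 < K)%N by near: K; exact: nbhs_infty_gt.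
have Kb0 : 0 < K%:R `^ beta^-1 :> R by rewrite powR_gt0// ltr0n.
have BK : B < t * K%:R `^ beta^-1.
  rewrite mulrC -ltr_pdivrMr//.
  apply: (@lt_le_trans _ _ (`|B / t| + 1)).
    by rewrite (le_lt_trans (ler_norm _))// ltrDl.
  have -> : `|B / t| + 1 = ((`|B / t| + 1) `^ beta) `^ beta^-1.
    by rewrite -powRrM mulfV ?gt_eqF// powRr1// addr_ge0.
  rewrite ge0_ler_powR ?nnegrE ?powR_ge0 ?invr_ge0 ?ler0n ?(ltW beta0)//.
  by near: K; exact: nbhs_infty_ger.
have AKt x : AK K x -> l1 x < t.
  move=> /AB; rewrite /l1_ball/= l1Z => /lt_trans/(_ BK).
  by rewrite mulrC ltr_pM2r.
have hK : nu_h (AK K) = (K%:R^-1 * fine (nu_h A))%:E.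
  rewrite /nu_h (orthant_measure_scale mh hh Kb0 mA) powR_root_opp// EFinM.
  by rewrite fineK// ge0_fin_numE.
have sK : nu_s (AK K) = (K%:R^-1 * S)%:E.
  rewrite /nu_s (orthant_measure_scale _ (homogeneous_l1_power hn _) Kb0 mA).
  by rewrite powR_root_opp// EFinM fineK// ge0_fin_numE.
have rK : nu_rho (AK K) = (fine (nu_rho (AK K)))%:E.
  by rewrite fineK// ge0_fin_numE// rA.
have le1 : (nu_rho (AK K) <= 1%:E * nu_h (AK K) + ep%:E * nu_s (AK K))%E.
  apply: orthant_measure_le => // x xA xo; have := ht _ xo (AKt _ xA).
  by rewrite ler_norml mul1r => /andP[_]; lra.
have le2 : (nu_h (AK K) <= 1%:E * nu_rho (AK K) + ep%:E * nu_s (AK K))%E.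
  apply: orthant_measure_le => // x xA xo; have := ht _ xo (AKt _ xA).
  by rewrite ler_norml mul1r => /andP[+ _]; lra.
move: le1 le2; rewrite rK hK sK -!EFinM -!EFinD !lee_fin !mul1r.
set P := fine _; set H := fine _ => le1 le2.
have k0 : (0 : R) < K%:R by rewrite ltr0n.
have epS : ep * S <= e.
  rewrite /ep mulrAC ler_pdivrMr ?ltr_wpDl// ler_pM2l//; lra.
have kS : K%:R * (ep * (K%:R^-1 * S)) = ep * S.
  by rewrite mulrCA (mulrA K%:R) mulfV ?gt_eqF// mul1r.
have kH : K%:R * (K%:R^-1 * H) = H by rewrite mulrA mulfV ?gt_eqF// mul1r.
have := ler_wpM2l (ltW k0) le1; rewrite mulrDr kS kH => le1'.
have := ler_wpM2l (ltW k0) le2; rewrite mulrDr kS kH => le2'.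
by rewrite ler_norml; apply/andP; split; lra.
Unshelve. all: by end_near. Qed.

End rate.

(** * Minima of independent copies *)

(** Both bounds come from [1 + t <= exp t], used at [t = - u] and at
    [t = u / (1 - u)]. *)
Lemma cvg_expr_expR (R : realType) (u : nat -> R) (l : R) :
  (forall K, 0 <= u K) -> K%:R * u K @[K --> \oo] --> l ->
  (1 - u K) ^+ K @[K --> \oo] --> expR (- l).
Proof.
move=> u0 ul.
have inv0 : (K%:R^-1 : R) @[K --> \oo] --> (0 : R).
  by rewrite -cvg_shiftS; exact: cvg_harmonic.
have ucvg0 : u K @[K --> \oo] --> (0 : R).
  rewrite -(mul0r l); apply: cvg_trans (cvgM inv0 ul); apply: near_eq_cvg.
  near=> K => /=; rewrite mulrA mulVf ?mul1r// pnatr_eq0 -lt0n.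
  by near: K; exact: nbhs_infty_gt.
have u1 : \forall K \near \oo, u K < 1.
  have /cvgrPdist_lt/(_ 1 ltr01) := ucvg0; apply: filterS => K.
  by rewrite sub0r normrN ger0_norm.
apply: (@squeeze_cvgr _ _ _ _
  (fun K => expR (- (K%:R * u K / (1 - u K))))
  (fun K => expR (- (K%:R * u K)))).
- near=> K; have uK1 : u K < 1 by near: K.
  have u10 : 0 < 1 - u K by rewrite subr_gt0.
  apply/andP; split.
    rewrite -mulrA -mulrN expRM_natl lerXn2r ?nnegrE ?expR_ge0 ?(ltW u10)//.
    rewrite expRN -[leRHS]invrK lef_pV2 ?posrE ?expR_gt0 ?invr_gt0//.
    apply: le_trans (expR_ge1Dx _).
    rewrite le_eqVlt; apply/orP; left; apply/eqP; field.
    by rewrite gt_eqF.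
  rewrite -mulrN expRM_natl lerXn2r ?nnegrE ?expR_ge0 ?(ltW u10)//.
  exact: (expR_ge1Dx (- u K)).
- apply: cvg_comp; last exact: continuous_expR.
  apply: cvgN; rewrite -[X in _ --> X]divr1 -[X in _ / X]subr0.
  apply: cvgM => //; apply: cvgV; first by rewrite subr0.
  by apply: cvgB => //; exact: cvg_cst.
- apply: cvg_comp; last exact: continuous_expR.
  exact: cvgN.
Unshelve. all: by end_near. Qed.

Section independent_minima.
Context {R : realType} {n : nat}.
Context {dC : measure_display} {TC : measurableType dC} (PC : probability TC R).
Context {d : measure_display} {T : measurableType d} (P : probability T R).
Variables (C : {RV PC >-> 'rV[R]_n}) (ell : nat -> 'rV[R]_n -> T -> R).
Variable D : set 'rV[R]_n.
Hypothesis hell : independent_copies D P PC ell (fun p w => dotr (C w) p).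
Variables (r : nat) (p : 'I_r -> 'rV[R]_n) (pD : forall i, D (p i)).

Lemma measurable_all_above (c : 'I_r -> R) :
  measurable [set w | forall i, c i <= dotr (C w) (p i)].
Proof.
rewrite (_ : [set _ | _] = \bigcap_(i in [set: 'I_r])
    (C @^-1` ((fun x => dotr x (p i)) @^-1` `[c i, +oo[))).
  apply: fin_bigcap_measurable => // i _; do 2 apply: measurable_preimage => //.
  under eq_fun do rewrite dotrC.
  exact: measurable_dotr.
apply/seteqP; split=> [w wc i _|w wc i]; first by rewrite /= in_itv/= andbT.
by have := wc i I; rewrite /= in_itv/= andbT.
Qed.

Lemma probability_all_above (K : nat) (c : 'I_r -> R) :
  P [set w | forall k, (k < K)%N -> forall i, c i <= ell k (p i) w] =
  (fine (PC [set w | forall i, c i <= dotr (C w) (p i)]) ^+ K)%:E.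
Proof.
have [mell lawE indep] := hell.
pose E k := [set w | forall i, c i <= ell k (p i) w].
pose J : {fset nat} := [fset k in iota 0 K]%fset.
have JE k : (k \in J) = (k < K)%N by rewrite /J in_fset/= mem_iota.
have -> : [set w | forall k, (k < K)%N -> forall i, c i <= ell k (p i) w] =
    \bigcap_(k in [set` J]) E k.
  apply/seteqP; split=> [w wE k /=|w wE k kK]; first by rewrite JE => /wE.
  by apply: wE => /=; rewrite JE.
rewrite indep; last first.
  move=> k _.
  have -> : E k = \bigcap_(i in [set: 'I_r]) (ell k (p i) @^-1` `[c i, +oo[).
    apply/seteqP; split=> [w wE i _|w wE i].
      by rewrite /= in_itv/= andbT; exact: wE.
    by have := wE i I; rewrite /= in_itv/= andbT.
  set G := \bigcup_(q in D) preimage_set_system [set: T] (ell k q) measurable.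
  apply: (@fin_bigcap_measurable _ (g_sigma_algebraType G)) => // i _.
  apply: sub_sigma_algebra; exists (p i) => //; exists `[c i, +oo[%classic => //.
  by rewrite setTI.
have PE k : P (E k) = (fine (PC [set w | forall i, c i <= dotr (C w) (p i)]))%:E.
  rewrite fineK ?fin_num_measure//; last exact: measurable_all_above.
  have mB : measurable [set y : 'rV[R]_r | forall i, `[c i, +oo[%classic (y 0 i)].
    by apply: (measurable_box (A := fun i => _)) => i; exact: measurable_itv.
  have := lawE k r p pD _ mB.
  rewrite (_ : [set w | _] = E k); last first.
    by apply/seteqP; split=> w /= wE i; have := wE i; rewrite mxE/= in_itv/= andbT.
  move=> ->; congr (PC _).
  by apply/seteqP; split=> w /= wE i; have := wE i; rewrite mxE/= in_itv/= andbT.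
under eq_bigr do rewrite PE.
rewrite prodEFin; congr _%:E.
rewrite big_const_seq count_predT.
have -> : size J = K.
  have : #|` J| = K by rewrite card_fseq undup_id ?iota_uniq// size_iota.
  by [].
by elim: K {J JE E PE} => [|K IH]; rewrite ?expr0//= IH exprS.
Qed.

Variable rho : 'rV[R]_n -> R.
Hypothesis Crho : has_density PC C rho.

Lemma density_total : orthant_measure Crho.1 setT = 1%E.
Proof.
by rewrite [LHS]density_measureE -Crho.2// preimage_setT probability_setT.
Qed.

Lemma probability_above (c : 'I_r -> R) :
  PC [set w | forall i, c i <= dotr (C w) (p i)] =
  (1 - orthant_measure Crho.1 (region_union p c))%E.
Proof.
have mc := measurable_all_above c.
rewrite -[X in PC X]setCK probability_setC//; last exact: measurableC.
congr (1 - _)%E.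
pose B := \bigcup_(i in [set: 'I_r]) [set x | dotr (p i) x < c i].
have mB : measurable B.
  apply: fin_bigcup_measurable => // i _.
  by apply: measurable_lt; exact: measurable_dotr.
rewrite (_ : ~` _ = C @^-1` B); last first.
  apply/seteqP; split=> w /=.
    move=> /existsNP[i /negP]; rewrite -ltNge dotrC => wi.
    by exists i.
  by move=> [i _ wi]; apply/existsNP; exists i; apply/negP; rewrite -ltNge dotrC.
rewrite Crho.2//.
rewrite orthant_measure_sub; last by move=> x [i _ []].
congr integral.
apply/seteqP; split=> x.
  by move=> [[i _ xi] xo]; exists i.
by move=> [i _ [xo xi]]; split=> //; exists i.
Qed.

End independent_minima.

(** * Convergence of the survival probabilities *)

Section region_union.
Context {R : realType} {n : nat}.

(** The weights are positive, so [<p i, x> < a i] bounds every coordinate of [x]. *)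
Lemma region_union_l1_ball r (p : 'I_r -> 'rV[R]_n) (a : 'I_r -> R) :
  (forall i, orthant (p i)) -> exists B, region_union p a `<=` l1_ball B.
Proof.
move=> p0; exists (\sum_i \sum_j `|a i| / p i 0 j + 1) => x [i _ [xo xa]].
rewrite /l1_ball/= ltr_pwDr//.
apply: (@le_trans _ _ (\sum_j `|a i| / p i 0 j)).
  apply: ler_sum => j _; rewrite ler_pdivlMr ?p0// mulrC.
  apply: le_trans (ler_norm (a i)); apply: le_trans (ltW xa).
  rewrite /dotr (bigD1 j)//= lerDl sumr_ge0// => k _.
  by rewrite mulr_ge0// ltW// ?p0// xo.
rewrite [leRHS](bigD1 i)//= lerDl; apply: sumr_ge0 => k _.
by apply: sumr_ge0 => j _; rewrite divr_ge0// ltW// p0.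
Qed.

Lemma simplex_orthant (p : 'rV[R]_n) : simplex p -> orthant p.
Proof. by move=> [p0 _] i; have /andP[] := p0 i. Qed.

End region_union.

Lemma scaled_min_ge (R : realType) (n : nat) (T : Type) (alpha : R)
    (ell : nat -> 'rV[R]_n -> T -> R) K p w a : (0 < K)%N ->
  a <= scaled_min alpha ell K p w <->
  forall k, (k < K)%N -> (K%:R `^ (n%:R + alpha)^-1)^-1 * a <= ell k p w.
Proof.
move=> K0; rewrite /scaled_min.
have b0 : 0 < K%:R `^ (n%:R + alpha)^-1 :> R by rewrite powR_gt0// ltr0n.
rewrite -ler_pdivrMl//; split.
  by move=> /bigmin_geP[_ ka] k kK; have := ka (Ordinal kK) isT.
by move=> ka; apply/bigmin_geP; split=> [|k _]; exact: ka.
Qed.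

Section survival.
Context {R : realType} {n : nat} (hn : (2 <= n)%N).
Context {dC : measure_display} {TC : measurableType dC} (PC : probability TC R).
Variables (C : {RV PC >-> 'rV[R]_n}).
Variables (alpha : R) (h : 'rV[R]_n -> R).
Hypothesis hh : asymptotically_homogeneous PC C alpha h.

Let mh : nonneg_measurable h := hh.1.

Let asymptotics : exists (rho : 'rV[R]_n -> R) (Crho : has_density PC C rho),
  [/\ homogeneous alpha h, (orthant_measure Crho.1 setT < +oo)%E &
  forall e, 0 < e -> exists2 t, 0 < t &
    forall x, orthant x -> l1 x < t -> `|rho x - h x| <= e * l1_power alpha x].
Proof.
have [_ [h_pos [rho [Crho rho_lim rho_unif]]]] := hh.
exists rho, Crho; split; first exact: limit_homogeneous rho_lim.
  by rewrite density_total ltry.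
exact: density_close.
Qed.

Lemma limit_density_homogeneous : homogeneous alpha h.
Proof. by have [? [? []]] := asymptotics. Qed.

Lemma asymptotic_exponent_gt0 : 0 < n%:R + alpha.
Proof.
have [rho [Crho [h_hom rho_fin close]]] := asymptotics.
exact: (exponent_gt0 hn mh h_hom close rho_fin hh.2.1).
Qed.

Lemma limit_density_ball_fin t : (orthant_measure mh (l1_ball t) < +oo)%E.
Proof.
have [rho [Crho [h_hom rho_fin close]]] := asymptotics.
exact: (homogeneous_ball_fin hn mh h_hom close rho_fin hh.2.1).
Qed.

Lemma region_union_fin r (p : 'I_r -> 'rV[R]_n) (a : 'I_r -> R) :
  (forall i, simplex (p i)) ->
  orthant_measure mh (region_union p a) \is a fin_num.
Proof.
move=> hp; rewrite ge0_fin_numE//.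
have [|B aB] := @region_union_l1_ball _ _ _ p a.
  by move=> i; exact: simplex_orthant.
apply: le_lt_trans (limit_density_ball_fin B).
rewrite le_measure// ?inE//; first exact: measurable_region_union.
exact: measurable_l1_ball.
Qed.

Lemma region_scale (p : 'rV[R]_n) a : 0 < a ->
  orthant_measure mh (region p a) =
  ((a `^ (n%:R + alpha))%:E * orthant_measure mh (region p 1))%E.
Proof.
move=> a0; have a1 : 0 < a^-1 by rewrite invr_gt0.
rewrite (_ : region p a = (fun x => a^-1 *: x) @^-1` region p 1).
  rewrite (orthant_measure_scale mh limit_density_homogeneous)//; last first.
    exact: measurable_region.
  by rewrite -powR_inv1 ?ltW// -powRrM mulN1r opprK.
apply/seteqP; split=> x; rewrite /region/=.
  move=> [xo xa]; split; first exact/(orthantZ _ a1).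
  by rewrite dotrZ ltr_pdivrMl// mulr1.
move=> [/(orthantZ _ a1) xo]; rewrite dotrZ ltr_pdivrMl// mulr1 => xa.
by split.
Qed.

(** The regions [<p, x> < k] exhaust the orthant and all have mass proportional to
    that of [<p, x> < 1]. *)
Lemma region1_gt0 (p : 'rV[R]_n) : (0 < orthant_measure mh (region p 1))%E.
Proof.
rewrite measure_gt0; apply/negP => /eqP p0; have := hh.2.1.
rewrite -(orthant_measure_sub mh (@subset_refl _ _)) measure_gt0 => /negP; apply.
rewrite (_ : @orthant R n = \bigcup_k region p k.+1%:R).
  apply/eqP; apply: (@measure_bigcup_eq0 _ _ _ (orthant_measure mh)) => k.
    exact: measurable_region.
  by rewrite region_scale// p0 mule0.
apply/seteqP; split=> [x xo|x [k _ []]//].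
by exists (Num.truncn (dotr p x)) => //; split=> //; exact: truncnS_gt.
Qed.

Context {d : measure_display} {T : measurableType d} (P : probability T R).
Variable ell : nat -> 'rV[R]_n -> T -> R.
Hypothesis hell : independent_copies (closure (@simplex R n)) P PC ell
  (fun p w => dotr (C w) p).

(** All the minima are above their thresholds when every copy of [C] avoids
    [K^(-1/beta)] times the union of regions; this has probability [(1 - u K)^K]
    where [K * u K] converges by [density_rate]. *)
Lemma survival_cvg r (p : 'I_r -> 'rV[R]_n) (a : 'I_r -> R) :
  (forall i, simplex (p i)) ->
  P [set w | forall i, a i <= scaled_min alpha ell K (p i) w]
    @[K --> \oo] -->
  expeR (- orthant_measure mh (region_union p a))%E.
Proof.
move=> hp.
have [rho [Crho [h_hom rho_fin close]]] := asymptotics.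
have [B aB] : exists B, region_union p a `<=` l1_ball B.
  by apply: region_union_l1_ball => i; exact: simplex_orthant.
have mU := measurable_region_union p a.
have := density_rate (mh := mh) hn h_hom close rho_fin hh.2.1 mU aB.
set nu_h := orthant_measure mh; set nu_rho := orthant_measure Crho.1.
have hfin : nu_h (region_union p a) \is a fin_num by exact: region_union_fin.
pose b K : R := K%:R `^ (n%:R + alpha)^-1.
pose u K := fine (nu_rho ((fun x => b K *: x) @^-1` region_union p a)).
have mS K : measurable ((fun x => b K *: x) @^-1` region_union p a).
  by apply: measurable_preimage => //; exact: measurable_scale.
have rfin X : measurable X -> nu_rho X \is a fin_num.
  move=> mX; rewrite ge0_fin_numE//; apply: le_lt_trans rho_fin.
  by rewrite le_measure// ?inE.
rewrite (_ : (fun K : nat => _) = (fun K => (K%:R * u K)%:E)); last first.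
  by apply/funext => K; rewrite EFinM fineK ?rfin.
rewrite -(fineK hfin) => /fine_cvg/= uh.
have ucvg : ((1 - u K) ^+ K)%:E @[K --> \oo] -->
    (expR (- fine (nu_h (region_union p a))))%:E.
  apply: cvg_EFin; first exact: nearW.
  by apply: cvg_expr_expR => // K; rewrite fine_ge0.
rewrite -?[X in expeR (- X)%E](fineK hfin) /=; apply: cvg_trans ucvg; apply: near_eq_cvg; near=> K.
have K0 : (0 < K)%N by near: K; exact: nbhs_infty_gt.
have b0 : 0 < b K by rewrite powR_gt0// ltr0n.
rewrite (_ : [set w | _] = [set w | forall k, (k < K)%N -> forall i,
    (b K)^-1 * a i <= ell k (p i) w]); last first.
  apply/seteqP; split=> w wE.
    by move=> k kK i; have /scaled_min_ge := wE i; exact.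
  by move=> i; apply/scaled_min_ge => // k kK; exact: wE.
rewrite (probability_all_above hell); last first.
  by move=> i; exact/subset_closure/hp.
rewrite (probability_above _ Crho) -region_unionZ// -/nu_rho fineB ?rfin//.
Unshelve. all: by end_near. Qed.

End survival.

(** * Half-open boxes *)

Section boxes.
Context {R : realType} {r : nat}.
Implicit Types a b : 'I_r -> R.

Definition upper_box a : set 'rV[R]_r := [set y | forall i, a i <= y 0 i].

Definition halfopen_box a b : set 'rV[R]_r :=
  [set y | forall i, a i <= y 0 i < b i].

Lemma measurable_upper_box a : measurable (upper_box a).
Proof.
rewrite (_ : upper_box a = [set y | forall i, `[a i, +oo[%classic (y 0 i)]).
  by apply: (measurable_box (A := fun i => _)) => i; exact: measurable_itv.
by apply/seteqP; split=> y ya i; have := ya i; rewrite /= in_itv/= andbT.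
Qed.

Lemma measurable_halfopen_box a b : measurable (halfopen_box a b).
Proof.
rewrite (_ : halfopen_box a b = [set y | forall i, `[a i, b i[%classic (y 0 i)]).
  by apply: (measurable_box (A := fun i => _)) => i; exact: measurable_itv.
by apply/seteqP; split=> y ya i; have := ya i; rewrite /= in_itv/=.
Qed.

(** A half-open box is obtained from upper boxes by imposing [y i < b i] one
    coordinate at a time: each step removes from a set the subset of the same
    kind with [a i] replaced by [b i].  Equality and convergence of measures
    both pass to such differences; [adm] restricts the corners. *)
Lemma halfopen_box_ind (adm : R -> Prop) (Q : set 'rV[R]_r -> Prop) :
  (forall A B, measurable A -> measurable B -> B `<=` A ->
    Q A -> Q B -> Q (A `\` B)) ->
  (forall a, (forall i, adm (a i)) -> Q (upper_box a)) ->
  forall a b, (forall i, adm (a i)) -> (forall i, adm (b i)) ->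
  (forall i, a i <= b i) -> Q (halfopen_box a b).
Proof.
move=> QD Qu.
pose B j a b : set 'rV[R]_r :=
  [set y | forall i : 'I_r, a i <= y 0 i /\ ((i < j)%N -> y 0 i < b i)].
suff QB j : (j <= r)%N -> forall a b, (forall i, adm (a i)) ->
    (forall i, adm (b i)) -> (forall i, a i <= b i) ->
    measurable (B j a b) /\ Q (B j a b).
  move=> a b aa ab leab; rewrite (_ : halfopen_box a b = B r a b).
    exact: (QB r _ _ _ _ _ _).2.
  apply/seteqP; split=> y yab i; have := yab i; first by move=> /andP[].
  by move=> [-> ->].
elim: j => [_|j IH jr] a b aa ab leab.
  rewrite (_ : B 0%N a b = upper_box a); last first.
    by apply/seteqP; split=> y ya i; have := ya i => // -[].
  by split; [exact: measurable_upper_box|exact: Qu].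
pose a' (i : 'I_r) := if i == j :> nat then b i else a i.
have [mB QBa] := IH (ltnW jr) _ _ aa ab leab.
have [mB' QBa'] : measurable (B j a' b) /\ Q (B j a' b).
  apply: (IH (ltnW jr)) => // i; rewrite /a'; case: ifPn => // _.
have -> : B j.+1 a b = B j a b `\` B j a' b.
  apply/seteqP; split=> y.
    move=> yB; split=> [i|yB'].
      by split; [exact: (yB i).1|move=> ij; apply: (yB i).2; rewrite ltnS ltnW].
    have := (yB (Ordinal jr)).2 (leqnn _); have := (yB' (Ordinal jr)).1.
    by rewrite /a' eqxx leNgt => /negP.
  move=> [yB yB'] i; split; first exact: (yB i).1.
  rewrite ltnS leq_eqVlt => /predU1P[ij|]; last exact: (yB i).2.
  rewrite ltNge; apply/negP => by_; apply: yB' => k; split; last exact: (yB k).2.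
  rewrite /a'; case: ifPn => [/eqP kj|_]; last exact: (yB k).1.
  by have -> : k = i by apply/val_inj; rewrite /= kj ij.
split; first exact: measurableD.
apply: QD => // y yB i; split; last exact: (yB i).2.
by apply: le_trans (yB i).1; rewrite /a'; case: ifPn.
Qed.

End boxes.

(** * Laws with a given exponent measure *)

Section min_convolution.
Local Open Scope ereal_scope.
Context {R : realType} {r : nat}.

Definition cmin (yz : 'rV[R]_r * 'rV[R]_r) : 'rV[R]_r :=
  (\row_i Num.min (yz.1 0 i) (yz.2 0 i))%R.

Lemma measurable_cmin : measurable_fun setT cmin.
Proof.
apply: measurable_fun_rVP => i; under eq_fun do rewrite mxE.
by apply: measurable_minr;
  [apply: (measurableT_comp (measurable_coord i)); exact: measurable_fst|
   apply: (measurableT_comp (measurable_coord i)); exact: measurable_snd].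
Qed.

(** The sets on which independent minima are multiplicative: the law of the
    minimum of two independent points charges such a set with the product of the
    masses. *)
Definition min_closed (A : set 'rV[R]_r) := cmin @^-1` A = A `*` A.

Lemma min_closed_upper_box a : min_closed (upper_box a).
Proof.
apply/seteqP; split=> [[y z] yza|[y z] [ya za] i]; last first.
  by rewrite mxE le_min ya za.
by split=> i; have := yza i; rewrite mxE le_min => /andP[].
Qed.

Lemma min_closed_coord i (t : R) :
  min_closed [set y : 'rV[R]_r | (t <= y 0 i)%R].
Proof.
apply/seteqP; split=> [[y z]|[y z] [ya za]] /=; rewrite mxE le_min.
  by move=> /andP[].
by rewrite ya za.
Qed.

Variables sigma : {finite_measure set 'rV[R]_r -> \bar R}.

Section min_convolution_measure.
Variable mu : {finite_measure set 'rV[R]_r -> \bar R}.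

Definition min_convolution : set 'rV[R]_r -> \bar R :=
  image_measure (sigma \x mu) measurable_cmin.

HB.instance Definition _ := Measure.on min_convolution.

Lemma min_convolutionE A : measurable A -> min_closed A ->
  min_convolution A = sigma A * mu A.
Proof.
move=> mA Amin; rewrite /min_convolution/= /pushforward Amin.
exact: product_measure1E.
Qed.

Let min_convolution_fin : fin_num_fun min_convolution.
Proof.
apply: lty_fin_num_fun; rewrite [X in X < _](_ : _ = min_convolution setT)//.
rewrite min_convolutionE//; last by rewrite /min_closed preimage_setT setXTT.
by rewrite lte_mul_pinfty ?fin_num_measure// -ge0_fin_numE ?fin_num_measure.
Qed.

HB.instance Definition _ := Measure_isFinite.Build _ _ _ min_convolution
  min_convolution_fin.

End min_convolution_measure.

Variable c : 'rV[R]_r.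

Fixpoint min_power (k : nat) : {finite_measure set 'rV[R]_r -> \bar R} :=
  match k with
  | 0 => @dirac _ 'rV[R]_r c R
  | k'.+1 => min_convolution (min_power k')
  end.

Lemma min_powerE k A : measurable A -> min_closed A -> A c ->
  min_power k A = (fine (sigma A) ^+ k)%:E.
Proof.
move=> mA Amin Ac; elim: k => [|k IH].
  by rewrite /= diracE mem_set.
rewrite /= min_convolutionE// IH exprS EFinM fineK//.
exact: fin_num_measure.
Qed.

Let inv_fact_ge0 k : (0 <= k`!%:R^-1 :> R)%R.
Proof. by rewrite invr_ge0. Qed.

(** The law of the minimum of [c] and of the points of a Poisson process of
    intensity [sigma]; the term of index [k] accounts for the configurations
    with [k] points, of total weight [exp (- sigma setT) * (sigma setT)^k / k!]. *)
Definition poisson_min : set 'rV[R]_r -> \bar R :=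
  mscale (NngNum (expR_ge0 (- fine (sigma setT))))
    (mseries (fun k => mscale (NngNum (inv_fact_ge0 k)) (min_power k)) 0).

HB.instance Definition _ := Measure.on poisson_min.

(** All the points lie in [A]: this is the probability that none lies in [~` A],
    here obtained by summing the exponential series. *)
Lemma poisson_minE A : measurable A -> min_closed A -> A c ->
  poisson_min A = (expR (- fine (sigma (~` A))))%:E.
Proof.
move=> mA Amin Ac; rewrite /poisson_min/= /mscale/= /mseries/=.
have sE : \sum_(0 <= k <oo) mscale (NngNum (inv_fact_ge0 k)) (min_power k) A =
    (expR (fine (sigma A)))%:E.
  rewrite /expR -EFin_lim; last exact: is_cvg_series_exp_coeff.
  apply/congr_lim/funext => N /=; rewrite -sumEFin; apply: eq_bigr => k _.
  by rewrite /mscale/= min_powerE// -EFinM mulrC.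
rewrite sE -EFinM -expRD -fineN -fineD; last 2 first.
- by rewrite fin_numN fin_num_measure.
- exact: fin_num_measure.
congr (expR _)%:E.
rewrite -setTD measureD ?setTI//; last by rewrite ltey_eq fin_num_measure.
rewrite fineB ?fin_num_measure// fineD ?fin_numN ?fin_num_measure// fineN.
by rewrite opprB addrC.
Qed.

Let poisson_minT : poisson_min setT = 1.
Proof.
rewrite poisson_minE//; last by rewrite /min_closed preimage_setT setXTT.
by rewrite setCT measure0 oppr0 expR0.
Qed.

HB.instance Definition _ := Measure_isProbability.Build _ _ _ poisson_min
  poisson_minT.

End min_convolution.

Section halfopen_box_generation.
Context {R : realType} {r : nat}.

Definition halfopen_boxes : set (set 'rV[R]_r) :=
  [set B | exists a b : 'I_r -> R, B = halfopen_box a b].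

Lemma coord_bounded (y : 'rV[R]_r) :
  exists N : nat, forall i, - N%:R <= y 0 i /\ y 0 i < N%:R.
Proof.
pose s := \sum_i `|y 0 i|; exists (Num.truncn s).+1 => i.
have : `|y 0 i| < (Num.truncn s).+1%:R.
  apply: le_lt_trans (truncnS_gt s); rewrite /s (bigD1 i)//= lerDl.
  by apply: sumr_ge0.
by rewrite ltr_norml => /andP[/ltW].
Qed.

Lemma measurable_halfopen_boxes :
  @measurable _ 'rV[R]_r = <<s halfopen_boxes >>.
Proof.
apply/seteqP; split; last first.
  apply: smallest_sub; first exact: sigma_algebra_measurable.
  by move=> _ [a [b ->]]; exact: measurable_halfopen_box.
move=> A mA.
pose f : g_sigma_algebraType halfopen_boxes -> 'rV[R]_r := id.
suff mf : measurable_fun setT f by have := mf measurableT A mA; rewrite setTI.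
apply: measurable_fun_rVP => i.
apply: (measurability _ (RGenInftyO.measurableE R)) => // _ [_ [t ->] <-].
rewrite setTI.
rewrite (_ : _ @^-1` _ = \bigcup_N (halfopen_box (fun=> - N%:R)
    (fun j => if j == i then t else N%:R))); last first.
  apply/seteqP; split=> [y|y [N _ /(_ i)]]; rewrite /= in_itv/=; last first.
    by rewrite eqxx => /andP[].
  move=> yt; have [N yN] := coord_bounded y; exists N => // j.
  have [-> _]/= := yN j.
  by case: ifPn => [/eqP ->//|_]; exact: (yN j).2.
apply: bigcupT_measurable => N; apply: sub_sigma_algebra.
by do 2 eexists.
Qed.

Lemma setI_closed_halfopen_boxes : setI_closed halfopen_boxes.
Proof.
move=> _ _ [a [b ->]] [a' [b' ->]].
exists (fun i => Num.max (a i) (a' i)), (fun i => Num.min (b i) (b' i)).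
apply/seteqP; split=> [y [ya ya'] i|y ya].
  by move: (ya i) (ya' i) => /andP[? ?] /andP[? ?];
    rewrite ge_max lt_min; apply/and3P; split => //; apply/andP.
by split=> i; have := ya i; rewrite ge_max lt_min => /andP[/andP[? ?] /andP[? ?]];
  apply/andP.
Qed.

Lemma halfopen_boxes_cover :
  \bigcup_N halfopen_box (fun i : 'I_r => - N%:R) (fun=> N%:R) =
  [set: 'rV[R]_r].
Proof.
rewrite -subTset => y _; have [N yN] := coord_bounded y; exists N => // i.
by have [-> ->] := yN i.
Qed.

Lemma eq_measure_halfopen_box
    (m1 m2 : {finite_measure set 'rV[R]_r -> \bar R}) :
  (forall a b, m1 (halfopen_box a b) = m2 (halfopen_box a b)) ->
  forall A, measurable A -> m1 A = m2 A.
Proof.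
move=> m12; apply: (measure_unique halfopen_boxes
  (fun N => halfopen_box (fun=> - N%:R) (fun=> N%:R))).
- exact: measurable_halfopen_boxes.
- exact: setI_closed_halfopen_boxes.
- by move=> N; exists (fun=> - N%:R), (fun=> N%:R).
- exact: halfopen_boxes_cover.
- by move=> _ [a [b ->]]; exact: m12.
- by move=> N; rewrite ltey_eq fin_num_measure//; exact: measurable_halfopen_box.
Qed.

End halfopen_box_generation.

Section truncated_laws.
Local Open Scope ereal_scope.
Context {R : realType} {r : nat}.
Variable sigma : {measure set 'rV[R]_r -> \bar R}.
Variable D : set 'rV[R]_r.
Hypotheses (mD : measurable D) (sigma_fin : sigma (~` D) < +oo).

Let truncation : set 'rV[R]_r -> \bar R := mrestr sigma (measurableC mD).

HB.instance Definition _ := Measure.on truncation.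

Let truncation_fin : fin_num_fun truncation.
Proof.
by apply: lty_fin_num_fun; rewrite /= /truncation /mrestr setTI.
Qed.

HB.instance Definition _ := Measure_isFinite.Build _ _ _ truncation
  truncation_fin.

Lemma exists_truncated_law : D !=set0 -> exists mu : probability 'rV[R]_r R,
  forall A, measurable A -> min_closed A -> D `<=` A ->
    mu A = (expR (- fine (sigma (~` A))))%:E.
Proof.
move=> [c Dc]; exists (poisson_min truncation c) => A mA Amin DA.
rewrite /= poisson_minE//; last exact: DA.
by rewrite /= /truncation /mrestr setIidl//; exact: subsetC.
Qed.

End truncated_laws.

(** [law k] is a candidate for the law sought, correct as far as the thresholds
    do not exceed [k + 1]. *)
Section gluing.
Local Open Scope ereal_scope.
Context {R : realType} {r : nat}.
Variables (sigma : set 'rV[R]_r -> \bar R) (law : nat -> probability 'rV[R]_r R).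

Let cut (k : nat) : set 'rV[R]_r := upper_box (fun=> k.+1%:R).

Hypothesis lawE : forall k A, measurable A -> min_closed A -> cut k `<=` A ->
  law k A = (expR (- fine (sigma (~` A))))%:E.
Hypothesis sigma_large : forall i, (expR (- fine (sigma
  [set y | (y ord0 i < k.+1%:R)%R])))%:E @[k --> \oo] --> 0.

Let cutS k j : (k <= j)%N -> cut j `<=` cut k.
Proof.
by move=> kj y yj i; apply: le_trans (yj i); rewrite ler_nat ltnS.
Qed.

Let below k : set 'rV[R]_r := [set y | forall i, (y 0 i < k.+1%:R)%R].

Let measurable_below k : measurable (below k).
Proof.
rewrite (_ : below k =
    [set y | forall i, `]-oo, k.+1%:R[%classic (y ord0 i)]).
  by apply: (measurable_box (A := fun i => _)) => i; exact: measurable_itv.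
by apply/seteqP; split=> y ya i; have := ya i; rewrite /= in_itv/=.
Qed.

Let restricted_law j k : set 'rV[R]_r -> \bar R :=
  mrestr (law j) (measurable_below k).

HB.instance Definition _ j k := Measure.on (restricted_law j k).

Let restricted_law_fin j k : fin_num_fun (restricted_law j k).
Proof.
apply: lty_fin_num_fun; rewrite /= /restricted_law /mrestr setTI.
by rewrite ltey_eq fin_num_measure.
Qed.

HB.instance Definition _ j k := Measure_isFinite.Build _ _ _
  (restricted_law j k) (@restricted_law_fin j k).

(** Below [k + 1], a half-open box only involves upper boxes with corners at most
    [k + 1], on which both laws are given by [lawE]. *)
Let law_below k A : measurable A ->
  law k (A `&` below k) = law k.+1 (A `&` below k).
Proof.
move=> mA; apply: (@eq_measure_halfopen_box _ _
  (restricted_law k k) (restricted_law k.+1 k)) => // a b.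
rewrite /= /restricted_law /mrestr.
pose b' i := Num.min (b i) k.+1%:R.
have -> : halfopen_box a b `&` below k = halfopen_box a b'.
  apply/seteqP; split=> [y [yab yk] i|y yab].
    by have /andP[-> yb] := yab i; rewrite lt_min yb yk.
  by split=> i; have := yab i; rewrite lt_min => /and3P[]// -> ->.
have [ab|/existsNP[i /negP]] := pselect (forall i, a i <= b' i)%R; last first.
  rewrite -ltNge => bai; rewrite (_ : halfopen_box _ _ = set0) ?measure0//.
  rewrite -subset0 => y /(_ i) /andP[ya yb].
  by have := lt_trans (le_lt_trans ya yb) bai; rewrite ltxx.
apply: (@halfopen_box_ind _ _ (fun x => x <= k.+1%:R)%R
  (fun B => law k B = law k.+1 B)) => //.
- move=> B1 B2 mB1 mB2 B21 e1 e2.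
  rewrite !measureD// ?setIidr//; try by rewrite ltey_eq fin_num_measure.
  by congr (_ - _).
- move=> a' a'k.
  have kU j : (k <= j)%N -> cut j `<=` upper_box a'.
    by move=> kj y /(cutS kj) yk i; exact: le_trans (a'k i) (yk i).
  by rewrite !lawE//; first [exact: measurable_upper_box
    | exact: min_closed_upper_box | exact: kU].
- by move=> i; rewrite (le_trans (ab i))// /b' ge_min lexx orbT.
- by move=> i; rewrite /b' ge_min lexx orbT.
Qed.

Let layer k := if k is k'.+1 then below k `\` below k' else below 0.

Let measurable_layer k : measurable (layer k).
Proof. by case: k => [|k] //=; exact: measurableD. Qed.

(** The layer between two consecutive boxes is charged as by the law that is
    correct on the larger one. *)
Let glued : set 'rV[R]_r -> \bar R :=
  mseries (fun k => mrestr (law k) (measurable_layer k)) 0.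

HB.instance Definition _ := Measure.on glued.

Let glued_cvg A : measurable A ->
  law N (A `&` below N) @[N --> \oo] --> glued A.
Proof.
move=> mA.
have lawS N : law N (A `&` below N) =
    \sum_(0 <= k < N.+1) mrestr (law k) (measurable_layer k) A.
  elim: N => [|N IH]; first by rewrite big_nat1.
  rewrite big_nat_recr//= -IH law_below// /mrestr.
  rewrite -measureU//.
  - congr (law _ _); rewrite -setIUr; congr (_ `&` _).
    rewrite setDE setUIr setUCr setIT setUidr//.
    by move=> y yN i; apply: lt_trans (yN i) _; rewrite ltr_nat.
  - exact: measurableI.
  - by apply: measurableI => //; exact: measurableD.
  - by rewrite -subset0 => y [[_ yN] [_ [_]]].
under eq_cvg do rewrite lawS.
have := is_cvg_nneseries (fun k _ _ =>
  measure_ge0 (mrestr (law k) (measurable_layer k)) A).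
move=> /(_ xpredT 0%N); rewrite -cvg_shiftS; exact.
Qed.

Let tail N : \bar R := \sum_(i <- fset_set [set: 'I_r])
  (expR (- fine (sigma [set y | (y ord0 i < N.+1%:R)%R])))%:E.

Let tail_cvg : tail N @[N --> \oo] --> 0.
Proof.
rewrite [X in _ --> X](_ : _ = \sum_(i <- fset_set [set: 'I_r]) 0); last first.
  by rewrite big1.
by apply: cvg_nnesum => i _ //; apply: nearW => N; rewrite lee_fin expR_ge0.
Qed.

Let law_tail N : law N (~` below N) <= tail N.
Proof.
pose above i : set 'rV[R]_r := [set y | (N.+1%:R <= y ord0 i)%R].
have mabove i : measurable (above i).
  by apply: measurable_ge; exact: measurable_coord.
have finT : finite_set [set: 'I_r] by exact: finite_finset.
rewrite /tail -fsbig_finite//.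
rewrite [leRHS](_ : _ = \sum_(i \in [set: 'I_r]) law N (above i)); last first.
  apply: eq_fsbigr => i _; rewrite lawE//.
  - congr (expR (- fine (sigma _)))%:E; apply/seteqP; split=> y /=;
      by rewrite ltNge => /negP.
  - exact: min_closed_coord.
  - by move=> y; exact.
apply: content_sub_fsum => //; first by apply: measurableC; exact: measurable_below.
by move=> y /existsNP[i /negP]; rewrite -leNgt => yi; exists i.
Qed.

Let glued_eq A (l : R) : measurable A ->
  (\forall N \near \oo, law N A = l%:E) -> glued A = l%:E.
Proof.
move=> mA lA; apply: (@cvg_unique _ _ (law N (A `&` below N) @[N --> \oo])).
- exact: ereal_hausdorff.
- exact: glued_cvg.
apply: (@squeeze_cvge _ _ _ _ (fun N => l%:E - tail N) _ (fun=> l%:E)).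
- near=> N; have lawA : law N A = l%:E by near: N.
  have mAb : measurable (A `&` below N) by exact: measurableI.
  apply/andP; split; last first.
    by rewrite -lawA le_measure// ?inE//; exact: subIsetl.
  have tail_fin : tail N \is a fin_num by rewrite /tail sumEFin.
  rewrite leeBlDr// -lawA.
  apply: (@le_trans _ _ (law N (A `&` below N) + law N (~` below N))).
    have mU := measurableC (measurable_below N).
    apply: le_trans (measureU2 _ mAb mU).
    rewrite le_measure// ?inE//; first exact: measurableU.
    by move=> y Ay; have [|] := pselect (below N y); [left|right].
  by rewrite leeD2l.
- rewrite -[X in _ --> X]sube0; apply: cvgeB => //; exact: cvg_cst.
- exact: cvg_cst.
Unshelve. all: by end_near. Qed.

Let gluedT : glued setT = 1.
Proof. by apply: glued_eq => //; apply: nearW => N; rewrite probability_setT. Qed.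

HB.instance Definition _ := Measure_isProbability.Build _ _ _ glued gluedT.

Lemma exists_glued_law : exists mu : probability 'rV[R]_r R,
  forall a : 'I_r -> R,
    mu (upper_box a) = (expR (- fine (sigma (~` upper_box a))))%:E.
Proof.
exists glued => a; apply: glued_eq; first exact: measurable_upper_box.
near=> N; apply: lawE; [exact: measurable_upper_box|exact: min_closed_upper_box|].
move=> y yN i; apply: le_trans (yN i).
have : (\sum_j `|a j| <= N%:R)%R by near: N; exact: nbhs_infty_ger.
rewrite (bigD1 i)//= => aN; rewrite -natr1 (le_trans (ler_norm _))//.
rewrite ler_wpDr// (le_trans _ aN)// lerDl.
by apply: sumr_ge0.
Unshelve. all: by end_near. Qed.

End gluing.

(** [sigma] is the exponent measure of the law that is produced: the complement
    of [upper_box a] is the set of points that pull some coordinate of the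
    minimum strictly below [a].  The first hypothesis says that finitely many
    points matter below a given level, the second that every coordinate of the
    minimum is finite almost surely. *)
Lemma exists_min_law (R : realType) (r : nat)
    (sigma : {measure set 'rV[R]_r -> \bar R}) :
  (forall t : R, sigma (~` upper_box (fun=> t)) < +oo)%E ->
  (forall i, (expR (- fine (sigma [set y | y ord0 i < k.+1%:R])))%:E
    @[k --> \oo] --> 0%E) ->
  exists mu : probability 'rV[R]_r R, forall a : 'I_r -> R,
    mu (upper_box a) = (expR (- fine (sigma (~` upper_box a))))%:E.
Proof.
move=> sigma_fin sigma_large.
pose cut (k : nat) : set 'rV[R]_r := upper_box (fun=> k.+1%:R).
have /choice[law lawE] : forall k, exists mu : probability 'rV[R]_r R,
    forall A, measurable A -> min_closed A -> cut k `<=` A ->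
    mu A = (expR (- fine (sigma (~` A))))%:E.
  move=> k; apply: exists_truncated_law => //; first exact: measurable_upper_box.
    exact: sigma_fin.
  by exists (const_mx k.+1%:R) => i; rewrite mxE.
exact: exists_glued_law lawE sigma_large.
Qed.

Section limit_law.
Context {R : realType} {n : nat} (hn : (2 <= n)%N).
Context {dC : measure_display} {TC : measurableType dC} (PC : probability TC R).
Variables (C : {RV PC >-> 'rV[R]_n}).
Variables (alpha : R) (h : 'rV[R]_n -> R).
Hypothesis hh : asymptotically_homogeneous PC C alpha h.

Lemma region_union1 (p : 'rV[R]_n) a :
  region_union (fun _ : 'I_1 => p) (fun=> a) = region p a.
Proof. by apply/seteqP; split=> x; [case|exists ord0]. Qed.

Lemma region_fin (p : 'rV[R]_n) a : simplex p ->
  orthant_measure hh.1 (region p a) \is a fin_num.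
Proof. by move=> hp; rewrite -region_union1 (region_union_fin hn hh). Qed.

Lemma region1_fine_gt0 (p : 'rV[R]_n) : simplex p ->
  0 < fine (orthant_measure hh.1 (region p 1)).
Proof.
move=> hp; rewrite fine_gt0// (region1_gt0 hn hh)/= ltey_eq.
by rewrite region_fin.
Qed.

Lemma survival_coord_cvg0 (p : 'rV[R]_n) : simplex p ->
  expR (- fine (orthant_measure hh.1 (region p k.+1%:R))) @[k --> \oo] --> 0.
Proof.
move=> hp; set l := fine (orthant_measure hh.1 (region p 1)).
have l0 : 0 < l by exact: region1_fine_gt0.
have beta0 := asymptotic_exponent_gt0 hn hh.
apply/cvgrPdist_le => e e0; near=> k.
rewrite sub0r normrN ger0_norm ?expR_ge0// (region_scale hn)// fineM ?region_fin//.
rewrite /= -/l expRN -[leRHS]invrK lef_pV2 ?posrE ?invr_gt0 ?expR_gt0//.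
apply: le_trans (expR_ge1Dx _); rewrite ler_wpDl//.
rewrite -ler_pdivrMr//.
have -> : e^-1 / l = ((e^-1 / l) `^ (n%:R + alpha)^-1) `^ (n%:R + alpha).
  by rewrite -powRrM mulVf ?gt_eqF// powRr1// divr_ge0// ?invr_ge0// ltW.
apply: ge0_ler_powR; [exact: ltW|by rewrite nnegrE powR_ge0|by rewrite nnegrE|].
rewrite -natr1 ler_wpDr//.
by near: k; exact: nbhs_infty_ger.
Unshelve. all: by end_near. Qed.

Lemma exists_limit_law r (p : 'I_r -> 'rV[R]_n) : (forall i, simplex (p i)) ->
  exists mu : probability 'rV[R]_r R, forall a,
    mu (upper_box a) = expeR (- orthant_measure hh.1 (region_union p a))%E.
Proof.
move=> hp; pose f (x : 'rV[R]_n) : 'rV[R]_r := \row_i dotr (p i) x.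
have mf : measurable_fun setT f.
  by apply: measurable_fun_rVP => i; under eq_fun do rewrite mxE; exact: measurable_dotr.
pose sigma := image_measure (orthant_measure hh.1) mf.
have sigmaE a : sigma (~` upper_box a) = orthant_measure hh.1 (region_union p a).
  rewrite /sigma/= /pushforward/= /density.
  congr integral; apply/seteqP; split=> x [xa xo]; split=> //.
    have /existsNP[i /negP] := xa.
    by rewrite mxE -ltNge => xi; exists i.
  have [i _ [_ xi]] := xa; apply/existsNP; exists i; apply/negP.
  by rewrite mxE -ltNge.
have [||mu muE] := @exists_min_law R r sigma.
- by move=> t; rewrite sigmaE ltey_eq (region_union_fin hn hh).
- move=> i; apply: cvg_EFin; first exact: nearW.
  rewrite [X in X x @[x --> _] --> _](_ : _ = fun k => expR (- fine
      (orthant_measure hh.1 (region (p i) k.+1%:R)))).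
    exact: survival_coord_cvg0.
  apply/funext => k /=; congr (expR (- fine _)).
  rewrite /sigma/= /pushforward/= /density.
  congr integral; apply/seteqP; split=> x [] /=; rewrite mxE => xa xo //.
  by move: xa => [].
exists mu => a; rewrite muE sigmaE.
by rewrite -[in RHS](fineK (region_union_fin hn hh a hp)).
Qed.

End limit_law.

(** * Weak convergence from upper boxes *)

Section continuous_measurable.
Context {R : realType} {r : nat}.

(** An open set is the union of the cubes of rational mesh that it contains, and
    there are countably many such cubes. *)
Lemma open_measurable_rV (U : set 'rV[R]_r) : open U -> measurable U.
Proof.
move=> oU.
pose cube (zk : 'rV[int]_r * nat) : set 'rV[R]_r :=
  halfopen_box (fun i => (zk.1 ord0 i)%:~R / zk.2.+1%:R)
    (fun i => ((zk.1 ord0 i)%:~R + 1) / zk.2.+1%:R).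
rewrite (_ : U = \bigcup_(zk in [set zk | cube zk `<=` U]) cube zk); last first.
  apply/seteqP; split=> [x Ux|x [zk zkU]]; last exact: zkU.
  have /nbhs_ballP[e /= e0 eU] : nbhs x U by exact: open_nbhs_nbhs.
  pose k := Num.truncn e^-1.
  have ke : k.+1%:R^-1 < e.
    by rewrite -[ltRHS]invrK ltf_pV2 ?posrE ?invr_gt0//; exact: truncnS_gt.
  have k0 : (0 : R) < k.+1%:R by [].
  pose z : 'rV[int]_r := \row_i Num.floor (x ord0 i * k.+1%:R).
  have xz : cube (z, k) x.
    move=> i /=; rewrite mxE ler_pdivrMr// ltr_pdivlMr//.
    have /andP[-> ] := floor_itv (x ord0 i * k.+1%:R).
    by rewrite intrD.
  exists (z, k) => //= y yz; apply: eU; split=> // j i.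
  rewrite ord1 /ball/=.
  have /= /andP[x1 x2] := xz i; have /= /andP[y1 y2] := yz i.
  move: x1 x2 y1 y2; rewrite mulrDl mul1r => x1 x2 y1 y2.
  apply: lt_trans ke; set q := _^-1 in x1 x2 y1 y2 *.
  set w := _ * q in x1 x2 y1 y2.
  by rewrite ltr_norml; apply/andP; split; lra.
rewrite bigcup_mkcond; apply: countable_bigcupT_measurable => // zk.
by case: ifPn => // _; exact: measurable_halfopen_box.
Qed.

Lemma continuous_measurable_rV (f : 'rV[R]_r -> R) : continuous f ->
  measurable_fun setT f.
Proof.
move=> /continuousP cf.
apply: (measurability _ (RGenOInfty.measurableE R)) => // _ [_ [t ->] <-].
rewrite setTI; apply: open_measurable_rV; apply: cf.
exact: interval_open.
Qed.

End continuous_measurable.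

Section halfopen_box_cvg.
Context {R : realType} {r : nat}.
Context {d : measure_display} {T : measurableType d} (P : probability T R).
Variables (Z : nat -> T -> 'rV[R]_r) (mZ : forall K, measurable_fun setT (Z K)).
Variable mu : probability 'rV[R]_r R.
Hypothesis upper_cvg : forall a, (forall i, 0 < a i) ->
  P (Z K @^-1` upper_box a) @[K --> \oo] --> mu (upper_box a).

Lemma halfopen_box_cvg (a b : 'I_r -> R) : (forall i, 0 < a i) ->
  (forall i, a i <= b i) ->
  P (Z K @^-1` halfopen_box a b) @[K --> \oo] --> mu (halfopen_box a b).
Proof.
move=> a0 ab; apply: (@halfopen_box_ind _ _ (fun x => 0 < x)
    (fun A => P (Z K @^-1` A) @[K --> \oo] --> mu A)) => //; last first.
  by move=> i; exact: lt_le_trans (a0 i) (ab i).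
move=> A B mA mB BA cA cB.
have mP K D : measurable D -> measurable (Z K @^-1` D).
  by move=> mD; exact: measurable_preimage.
have -> : (fun K => P (Z K @^-1` (A `\` B))) =
    (fun K => P (Z K @^-1` A) - P (Z K @^-1` B))%E.
  apply/funext => K; rewrite -[LHS]/(P (Z K @^-1` A `\` Z K @^-1` B)) measureD ?setIidr//; try exact: mP.
  - exact: preimage_subset.
  - by rewrite ltey_eq fin_num_measure//; exact: mP.
rewrite measureD// ?setIidr//; last by rewrite ltey_eq fin_num_measure.
apply: cvgeB => //; apply: fin_num_adde_defr.
by rewrite fin_num_measure.
Qed.

End halfopen_box_cvg.

(** The [(N + 1)^2] steps of length [1 / (N + 1)] in each direction cover the
    coordinates from [1 / (N + 1)] to [N + 1]. *)
Notation cell_index r N := {ffun 'I_r -> 'I_(N.+1 ^ 2)}.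

Section lower_steps.
Context {R : realType} {r : nat}.
Variable f : 'rV[R]_r -> R.
Hypothesis f0 : forall y, 0 <= f y.

(** The corners are positive, as survival functions are only controlled at
    positive thresholds. *)
Definition cell N (z : cell_index r N) : set 'rV[R]_r :=
  halfopen_box (fun i => (z i).+1%:R / N.+1%:R)
    (fun i => (z i).+2%:R / N.+1%:R).

Lemma cell_inj N (z z' : cell_index r N) y :
  cell z y -> cell z' y -> z = z'.
Proof.
move=> zy zy'; apply/ffunP => i; apply/val_inj/eqP => /=.
have N0 : (0 : R) < N.+1%:R by [].
have := zy i; have := zy' i.
rewrite !ler_pdivrMr// !ltr_pdivlMr// => /andP[a1 a2] /andP[b1 b2].
have := le_lt_trans a1 b2; have := le_lt_trans b1 a2.
by rewrite !ltr_nat !ltnS eqn_leq => -> ->.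
Qed.

Definition cell_inf N (z : cell_index r N) : R := inf (f @` cell z).

Lemma cell_inf_le N (z : cell_index r N) y :
  cell z y -> cell_inf z <= f y.
Proof.
move=> zy; apply: ge_inf; last by exists y.
by exists 0 => _ [x _ <-].
Qed.

Lemma cell_inf_ge N (z : cell_index r N) y (l : R) : cell z y ->
  (forall x, cell z x -> l <= f x) -> l <= cell_inf z.
Proof.
move=> zy lf; apply: lb_le_inf; first by exists (f y); exists y.
by move=> _ [x zx <-]; exact: lf.
Qed.

Lemma cell_inf_ge0 N (z : cell_index r N) : 0 <= cell_inf z.
Proof.
apply: (@cell_inf_ge _ _ (\row_i ((z i).+1%:R / N.+1%:R))) => // i.
by rewrite mxE lexx ltr_pM2r ?invr_gt0// ltr_nat ltnSn.
Qed.

Definition lower_step N (y : 'rV[R]_r) : R :=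
  \sum_(z : cell_index r N) cell_inf z * \1_(cell z) y.

Lemma lower_stepE N (z : cell_index r N) y : cell z y ->
  lower_step N y = cell_inf z.
Proof.
move=> zy; rewrite /lower_step (bigD1 z)//= indicE mem_set// mulr1.
rewrite big1 ?addr0// => z' zz'; rewrite indicE memNset ?mulr0// => zy'.
by move: zz'; rewrite (cell_inj zy zy') eqxx.
Qed.

Lemma lower_step_ge0 N y : 0 <= lower_step N y.
Proof. by apply: sumr_ge0 => z _; rewrite mulr_ge0 ?cell_inf_ge0// indicE ler0n. Qed.

Lemma lower_step_le N y : lower_step N y <= f y.
Proof.
have [[z zy]|nz] := pselect (exists z : cell_index r N, cell z y).
  by rewrite (lower_stepE zy) cell_inf_le.
rewrite /lower_step big1// => z _; rewrite indicE memNset ?mulr0// => zy.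
by apply: nz; exists z.
Qed.

Lemma measurable_lower_step N : measurable_fun setT (lower_step N).
Proof.
apply: measurable_sum => z; apply: measurable_funM => //.
by apply: measurable_indic; exact: measurable_halfopen_box.
Qed.

Lemma cell_cover N (y : 'rV[R]_r) :
  (forall i, N.+1%:R^-1 <= y 0 i) -> (forall i, y 0 i <= N.+1%:R) ->
  exists z : cell_index r N, cell z y.
Proof.
move=> y1 y2; have N0 : (0 : R) < N.+1%:R by [].
pose k i := Num.truncn (y 0 i * N.+1%:R).
have kE i : (k i)%:R <= y 0 i * N.+1%:R < (k i).+1%:R.
  apply: truncn_itv; rewrite mulr_ge0//; apply: le_trans (y1 i).
  by rewrite invr_ge0.
have k0 i : (0 < k i)%N.
  by rewrite truncn_gt0 -ler_pdivrMr// mul1r.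
have kN i : ((k i).-1 < N.+1 ^ 2)%N.
  rewrite prednK// -(ler_nat R) natrX expr2.
  by have /andP[/le_trans->//] := kE i; rewrite ler_pM2r.
exists [ffun i => Ordinal (kN i)] => i; rewrite ffunE /=.
by rewrite ler_pdivrMr// ltr_pdivlMr// prednK.
Qed.

Lemma lower_step_cvg (y : 'rV[R]_r) : continuous f -> (forall i, 0 < y 0 i) ->
  lower_step N y @[N --> \oo] --> f y.
Proof.
move=> cf y0; apply/cvgrPdist_le => e e0.
have /cvgrPdist_le/(_ e e0)/nbhs_ballP[t /= t0 ht] := cf y.
have inv0 : (N.+1%:R^-1 : R) @[N --> \oo] --> (0 : R) by exact: cvg_harmonic.
have invlt u : 0 < u -> \forall N \near \oo, (N.+1%:R^-1 : R) < u.
  move=> u0; have /cvgrPdist_lt/(_ u u0) := inv0; apply: filterS => N.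
  by rewrite sub0r normrN gtr0_norm.
have [B yB] : exists B, forall i, y 0 i <= B.
  exists (\sum_j `|y 0 j|) => i; rewrite (le_trans (ler_norm _))//.
  by rewrite (bigD1 i)//= lerDl sumr_ge0.
have [m m0 ym] : exists2 m, 0 < m & forall i, m <= y 0 i.
  exists (\sum_j (y 0 j)^-1 + 1)^-1 => [|i].
    by rewrite invr_gt0 ltr_wpDl// sumr_ge0// => j _; rewrite invr_ge0 ltW.
  rewrite -[leRHS]invrK lef_pV2 ?posrE ?invr_gt0//; last first.
    by rewrite ltr_wpDl// sumr_ge0// => j _; rewrite invr_ge0 ltW.
  rewrite ler_wpDr// (bigD1 i)//= lerDl sumr_ge0// => j _.
  by rewrite invr_ge0 ltW.
near=> N.
have Nt : N.+1%:R^-1 < t by near: N; exact: invlt.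
have [i|i|z zy] := @cell_cover N y.
- by apply: le_trans (ym i); apply: ltW; near: N; exact: invlt.
- rewrite (le_trans (yB i))// -natr1 ler_wpDr//.
  by near: N; exact: nbhs_infty_ger.
rewrite ger0_norm ?subr_ge0 ?lower_step_le// lerBlDr -lerBlDl.
rewrite (lower_stepE zy); apply: (cell_inf_ge zy) => x zx.
have /ht/= : ball y t x.
  split=> // j i; rewrite ord1 /ball/=.
  have /andP[] := zx i; have /andP[] := zy i; rewrite -[(z i).+2%:R]natr1 !mulrDl mul1r.
  set q := _^-1 in Nt *; set w := _ * q => y1 y2 x1 x2.
  by apply: lt_trans Nt; rewrite ltr_norml; apply/andP; split; lra.
by rewrite ler_norml => /andP[_]; lra.
Unshelve. all: by end_near. Qed.

End lower_steps.

Section integral_lower_step.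
Context {R : realType} {r : nat}.
Context {d : measure_display} {T : measurableType d} (P : probability T R).
Variables (Z : T -> 'rV[R]_r) (mZ : measurable_fun setT Z).
Local Open Scope ereal_scope.

Let measurable_Z A : measurable A -> measurable (Z @^-1` A).
Proof. by move=> mA; exact: measurable_preimage. Qed.

Lemma integral_lower_step (f : 'rV[R]_r -> R) N : (forall y, (0 <= f y)%R) ->
  \int[P]_w (lower_step f N (Z w))%:E =
  \sum_(z : cell_index r N) (cell_inf f z)%:E * P (Z @^-1` cell z).
Proof.
move=> f0; rewrite /lower_step; under eq_integral do rewrite -sumEFin.
have mcell (z : cell_index r N) : measurable (Z @^-1` cell z).
  by apply: measurable_Z; exact: measurable_halfopen_box.
rewrite ge0_integral_sum//; last 2 first.
- move=> z; apply/measurable_EFinP; apply: measurable_funM => //.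
  exact: (measurable_indic (mcell z)).
- by move=> z w _; rewrite lee_fin mulr_ge0 ?cell_inf_ge0// indicE ler0n.
apply: eq_bigr => z _; under eq_integral do rewrite EFinM.
rewrite ge0_integralZl//; last 2 first.
- by apply/measurable_EFinP; exact: (measurable_indic (mcell z)).
- by rewrite lee_fin cell_inf_ge0.
congr (_ * _); rewrite -[X in P X]setIT -integral_indic//.
Qed.

Lemma bounded_integrable (f : 'rV[R]_r -> R) M : measurable_fun setT f ->
  (forall y, `|f y| <= M)%R -> P.-integrable setT (EFin \o (f \o Z)).
Proof.
move=> mf fM; apply: measurable_bounded_integrable => //.
- by rewrite ltey_eq fin_num_measure.
- exact: measurableT_comp.
- exists M; split=> [|x Mx w _ /=]; first exact: num_real.
  by rewrite (le_trans (fM _))// ltW.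
Qed.

End integral_lower_step.

Section weak_cvg.
Context {R : realType} {r : nat}.
Context {d : measure_display} {T : measurableType d} (P : probability T R).
Variables (Z : nat -> T -> 'rV[R]_r) (mZ : forall K, measurable_fun setT (Z K)).
Variable mu : probability 'rV[R]_r R.
Hypothesis upper_cvg : forall a, (forall i, 0 < a i) ->
  P (Z K @^-1` upper_box a) @[K --> \oo] --> mu (upper_box a).
Hypothesis mu_pos : mu (~` @orthant R r) = 0%E.

(** The integral of a step function on cells converges as it involves finitely
    many half-open boxes, it bounds that of [f] from below, and it is close to it
    for [mu] by dominated convergence. *)
Lemma expectation_liminf (f : 'rV[R]_r -> R) (M e : R) : continuous f ->
  (forall y, 0 <= f y <= M) -> 0 < e ->
  \forall K \near \oo, fine (\int[mu]_y (f y)%:E)%E - e <=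
                      fine (\int[P]_w (f (Z K w))%:E)%E.
Proof.
move=> cf f0M e0.
have f0 y : 0 <= f y by have /andP[] := f0M y.
have fM y : f y <= M by have /andP[] := f0M y.
have nfM y : `|f y| <= M by rewrite ger0_norm.
have mf := continuous_measurable_rV cf.
have stepM N y : `|lower_step f N y| <= M.
  by rewrite ger0_norm ?lower_step_ge0// (le_trans (lower_step_le f0 _ _)).
have fi (d' : measure_display) (T' : measurableType d') (P' : probability T' R)
    (Z' : T' -> 'rV[R]_r) (g : 'rV[R]_r -> R) : measurable_fun setT Z' ->
    measurable_fun setT g -> (forall y, `|g y| <= M) ->
    (\int[P']_w (g (Z' w))%:E)%E \is a fin_num.
  move=> mZ' mg gM; apply: integrable_fin_num => //.
  exact: (bounded_integrable P' mZ' mg gM).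
have step_cvg : (\int[mu]_y (lower_step f N y)%:E)%E @[N --> \oo] -->
    (\int[mu]_y (f y)%:E)%E.
  have [] := @dominated_convergence _ _ _ mu setT measurableT
    (fun N y => (lower_step f N y)%:E) (EFin \o f) (fun=> M%:E) => //.
  - by move=> N; apply/measurable_EFinP; exact: measurable_lower_step.
  - exact/measurable_EFinP.
  - exists (~` @orthant R r); split => //.
      by apply: measurableC; exact: measurable_orthant.
    move=> y /= ny yo; apply: ny => _; apply: cvg_EFin; first exact: nearW.
    exact: lower_step_cvg.
  - apply/integrableP; split => //; rewrite integral_cst//=.
    by rewrite lte_mul_pinfty// ?abse_ge0// ltey_eq fin_num_measure.
  - by apply: aeW => y N _; rewrite lee_fin.
have e20 : 0 < e / 2 by rewrite divr_gt0.
have [N fN] : exists N, fine (\int[mu]_y (f y)%:E)%E - e / 2 <=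
    fine (\int[mu]_y (lower_step f N y)%:E)%E.
  have /fine_cvgP[_ /cvgrPdist_le/(_ (e / 2))] : (\int[mu]_y (lower_step f N y)%:E)%E
      @[N --> \oo] --> (fine (\int[mu]_y (f y)%:E)%E)%:E.
    by rewrite fineK// (fi _ _ mu id).
  move=> /(_ e20)[N _ /(_ N (leqnn N))] /=.
  by rewrite ler_norml => /andP[_ ?]; exists N; lra.
have step_int : (\int[P]_w (lower_step f N (Z K w))%:E)%E @[K --> \oo] -->
    (\int[mu]_y (lower_step f N y)%:E)%E.
  rewrite (integral_lower_step mu (Z := id))//.
  under eq_cvg do rewrite integral_lower_step//.
  apply: cvg_nnesum => z _.
    by apply: nearW => K; rewrite mule_ge0// lee_fin cell_inf_ge0.
  apply: cvgeZl => //; apply: (halfopen_box_cvg mZ upper_cvg) => i /=.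
    by rewrite divr_gt0.
  by rewrite ler_pM2r ?invr_gt0// ler_nat.
have /fine_cvgP[_ /cvgrPdist_le/(_ (e / 2))] : (\int[P]_w (lower_step f N (Z K w))%:E)%E
    @[K --> \oo] --> (fine (\int[mu]_y (lower_step f N y)%:E)%E)%:E.
  by rewrite fineK// (fi _ _ mu id)//; exact: measurable_lower_step.
move=> /(_ e20); apply: filterS => K.
rewrite ler_norml => /andP[_ NK].
have : fine (\int[P]_w (lower_step f N (Z K w))%:E)%E <=
    fine (\int[P]_w (f (Z K w))%:E)%E.
  rewrite fine_le ?fi//; try exact: measurable_lower_step.
  apply: ge0_le_integral => //.
  - by move=> w _; rewrite lee_fin lower_step_ge0.
  - apply/measurable_EFinP; apply: measurableT_comp => //.
    exact: measurable_lower_step.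
  - by apply/measurable_EFinP; exact: measurableT_comp.
  - by move=> w _; rewrite lee_fin lower_step_le.
by move: NK => /=; lra.
Qed.

(** [expectation_liminf] applied to [M + f] and [M - f] bounds the integrals of
    [f] from both sides. *)
Lemma upper_box_cvg_in_distribution : cvg_in_distribution P Z mu id.
Proof.
move=> f cf [M fM].
have mf := continuous_measurable_rV cf.
have fi (d' : measure_display) (T' : measurableType d') (P' : probability T' R)
    (Z' : T' -> 'rV[R]_r) : measurable_fun setT Z' ->
    P'.-integrable setT (EFin \o (f \o Z')).
  by move=> mZ'; exact: (bounded_integrable P' mZ' mf fM).
have ffin (d' : measure_display) (T' : measurableType d') (P' : probability T' R)
    (Z' : T' -> 'rV[R]_r) : measurable_fun setT Z' ->
    (\int[P']_w (f (Z' w))%:E)%E \is a fin_num.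
  by move=> mZ'; apply: integrable_fin_num => //; exact: fi.
have mu_id : measurable_fun setT (id : 'rV[R]_r -> 'rV[R]_r) by [].
have shift (d' : measure_display) (T' : measurableType d') (P' : probability T' R)
    (Z' : T' -> 'rV[R]_r) (s : R) : measurable_fun setT Z' ->
    fine (\int[P']_w (M + s * f (Z' w))%:E)%E =
    M + s * fine (\int[P']_w (f (Z' w))%:E)%E.
  move=> mZ'.
  rewrite (_ : \int[P']_w _ = M%:E + s%:E * \int[P']_w (f (Z' w))%:E)%E.
    by rewrite fineD ?fineM ?fin_numM ?ffin.
  rewrite -integralZl//; last exact: fi.
  rewrite -[X in (X + _)%E]mule1 -(probability_setT P') -integral_cst//.
  rewrite -integralD//.
  - exact: finite_measure_integrable_cst.
  - by apply: integrableZl => //; exact: fi.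
rewrite -(fineK (ffin _ _ mu id mu_id)).
apply: cvg_EFin; first by apply: nearW => K; exact: ffin.
apply/cvgrPdist_le => e e0.
have c1 : continuous (fun y => M + 1 * f y).
  by move=> y; exact: (cvgD (cvg_cst _) (cvgM (cvg_cst _) (cf y))).
have c2 : continuous (fun y => M + (-1) * f y).
  by move=> y; exact: (cvgD (cvg_cst _) (cvgM (cvg_cst _) (cf y))).
have b1 y : 0 <= M + 1 * f y <= M + M.
  by have := fM y; rewrite ler_norml => /andP[? ?]; apply/andP; split; lra.
have b2 y : 0 <= M + (-1) * f y <= M + M.
  by have := fM y; rewrite ler_norml => /andP[? ?]; apply/andP; split; lra.
have l1 := expectation_liminf c1 b1 e0.
have l2 := expectation_liminf c2 b2 e0.
near=> K.
have : fine (\int[mu]_y (M + 1 * f y)%:E)%E - e <=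
    fine (\int[P]_w (M + 1 * f (Z K w))%:E)%E by near: K.
have : fine (\int[mu]_y (M + (-1) * f y)%:E)%E - e <=
    fine (\int[P]_w (M + (-1) * f (Z K w))%:E)%E by near: K.
rewrite !shift// => h2 h1.
by rewrite ler_norml; apply/andP; split; rewrite /=; lra.
Unshelve. all: by end_near. Qed.

End weak_cvg.

(** * The one-point marginal *)

Lemma measurable_scaled_min (R : realType) (n : nat) (d : measure_display)
    (T : measurableType d) (alpha : R) (ell : nat -> 'rV[R]_n -> T -> R) K p :
  (forall k, measurable_fun setT (ell k p)) ->
  measurable_fun setT (scaled_min alpha ell K p).
Proof.
move=> mell; apply: measurable_funM => //.
suff mmin (F : nat -> T -> R) (x : T -> R) : measurable_fun setT x ->
    (forall k, measurable_fun setT (F k)) ->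
    measurable_fun setT (fun w => \big[Num.min/x w]_(k < K) F k w).
  exact: (mmin (fun k => ell k p)).
move=> mx; elim: K F => [|K IH] F mF; first by under eq_fun do rewrite big_ord0.
under eq_fun do rewrite big_ord_recl/=.
by apply: measurable_minr => //; exact: (IH (fun k => F k.+1)).
Qed.

Definition exponential_measure (R : realType) (l : R) (l0 : 0 < l) :
    {measure set (measurableTypeR R) -> \bar R} :=
  density_measure (@lebesgue_measure R) measurableT
    (@measurable_exponential_pdf R l)
    (fun x _ => exponential_pdf_ge0 (ltW l0) x).

Lemma exponential_measureE (R : realType) (l : R) (l0 : 0 < l) A :
  exponential_measure l0 A = exponential_prob l A.
Proof. by rewrite [LHS]density_measureE setIT. Qed.

Lemma exponential_prob_ray (R : realType) (l t : R) : 0 < l ->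
  exponential_prob l `]t, +oo[ =
  if t < 0 then 1%E else (expR (- (l * t)))%:E.
Proof.
move=> l0; pose m := exponential_measure l0.
have mE A : m A = exponential_prob l A by exact: exponential_measureE.
have mT : m setT = 1%E by rewrite mE; exact: integral_exponential_pdf.
have m0 : m `]-oo, 0[%classic = 0%E.
  rewrite mE /exponential_prob integral0_eq// => x; rewrite /= in_itv/= => x0.
  by rewrite lt0_exponential_pdf.
have mc : m `]t, +oo[%classic = (1 - m `]-oo, t]%classic)%E.
  rewrite (_ : `]t, +oo[%classic = setT `\` `]-oo, t]%classic).
    rewrite measureD//; last by rewrite [X in (X < _)%E](_ : _ = 1%E) ?ltry.
    by rewrite setTI; congr (_ - _)%E.
  rewrite setTD; apply/seteqP; split=> x /=; rewrite !in_itv/= andbT.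
    by rewrite ltNge => /negP.
  by move=> /negP; rewrite ltNge.
rewrite -mE mc; case: ltP => t0.
  rewrite (_ : m `]-oo, t]%classic = 0%E) ?sube0//; apply/eqP.
  rewrite -measure_le0 -m0 le_measure// ?inE// => x /=.
  by rewrite !in_itv/= => /le_lt_trans; exact.
have -> : `]-oo, t]%classic = `]-oo, 0[%classic `|` `[0, t]%classic.
  apply/seteqP; split=> x /=; rewrite !in_itv/=.
    by have [x0 xt|x0 xt] := ltP x 0; [left|right].
  by move=> [/ltW/le_trans|/andP[]//]; exact.
have -> : m (`]-oo, 0[%classic `|` `[0, t]%classic) =
    (m `]-oo, 0%R[%classic + m `[0%R, t]%classic)%E.
  apply: measureU => //; rewrite -subset0 => x [] /=; rewrite !in_itv/= => x0.
  by rewrite leNgt x0.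
rewrite m0 add0e mE; have [->|tn0] := eqVneq t 0.
  rewrite set_itv1 /exponential_prob integral_set1 sube0.
  by rewrite mulr0 oppr0 expR0.
have tgt0 : 0 < t by rewrite lt0r tn0.
rewrite exponential_prob_itv0c// mulNr; set x := expR _.
transitivity (1%:E - (1%:E - x%:E))%E => //.
by rewrite -!EFinB; congr _%:E; ring.
Qed.

Section marginal.
Context {R : realType}.
Context {d : measure_display} {T : measurableType d} (P : probability T R).
Variables (Z : nat -> T -> R) (mZ : forall K, measurable_fun setT (Z K)).
Context {d' : measure_display} {T' : measurableType d'} (P' : probability T' R).
Variables (Psi : {RV P' >-> R}).
Hypothesis Z_Psi : cvg_in_distribution P Z P' Psi.

(** Without continuity of the limit law only neighbouring thresholds compare: a
    continuous function lies between the indicators of the rays from [a] and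
    from [s < a]. *)
Lemma cvg_in_distribution_tails (s a gs ga : R) : s < a ->
  P [set w | s <= Z K w] @[K --> \oo] --> gs%:E ->
  P [set w | a <= Z K w] @[K --> \oo] --> ga%:E ->
  (P' [set w | (a <= Psi w)%R] <= gs%:E)%E /\
  (ga%:E <= P' [set w | (s <= Psi w)%R])%E.
Proof.
move=> sa Pgs Pga.
(* [f] is continuous and piecewise linear, [0] below [s] and [1] above [a] *)
pose y (x : R) := (x - s) / (a - s).
pose f x := (1 + `|y x| - `|y x - 1|) / 2.
have as0 : 0 < a - s by rewrite subr_gt0.
have cy : continuous y.
  by move=> x; apply: cvgM; [apply: cvgB; [exact: cvg_id|exact: cvg_cst]|exact: cvg_cst].
have cf : continuous f.
  move=> x; apply: cvgM; last exact: cvg_cst.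
  apply: cvgB; [apply: cvgD; [exact: cvg_cst|]|].
    by apply: cvg_norm; exact: cy.
  by apply: cvg_norm; apply: cvgB; [exact: cy|exact: cvg_cst].
have f01 x : 0 <= f x <= 1.
  rewrite /f; have [] := ger0P (y x); have [] := ger0P (y x - 1) => *; lra.
have fs x : x < s -> f x = 0.
  move=> xs; have y0 : y x < 0 by rewrite pmulr_llt0 ?invr_gt0// subr_lt0.
  rewrite /f ltr0_norm// ltr0_norm; lra.
have fa x : a <= x -> f x = 1.
  move=> ax; have y1 : 1 <= y x by rewrite ler_pdivlMr// mul1r lerB.
  rewrite /f ger0_norm ?ger0_norm//; lra.
have mf : measurable_fun setT f by exact: continuous_measurable_fun.
have bounds (d0 : measure_display) (T0 : measurableType d0) (P0 : probability T0 R)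
    (X : T0 -> R) : measurable_fun setT X ->
    (P0 [set w | (a <= X w)%R] <= \int[P0]_w (f (X w))%:E <=
     P0 [set w | (s <= X w)%R])%E.
  move=> mX.
  have mge u : measurable [set w | u <= X w] by exact: measurable_ge.
  have indE u : P0 [set w | u <= X w] = (\int[P0]_w (\1_[set w | (u <= X w)%R] w)%:E)%E.
    by rewrite integral_indic// setIT.
  have mfX : measurable_fun setT (fun w => (f (X w))%:E).
    by apply/measurable_EFinP; exact: measurableT_comp.
  have mind u : measurable_fun setT (fun w => (\1_[set w | u <= X w] w : R)%:E).
    by apply/measurable_EFinP; exact: measurable_indic.
  rewrite !indE; apply/andP; split; apply: ge0_le_integral => //.
  - move=> w _; rewrite lee_fin indicE; case: (boolP (_ \in _)) => [|_].
      by rewrite inE/= => /fa ->.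
    by have /andP[] := f01 (X w).
  - by move=> w _; have /andP[] := f01 (X w); rewrite lee_fin.
  - move=> w _; rewrite lee_fin indicE; have [sX|Xs] := leP s (X w).
      by rewrite mem_set//; have /andP[] := f01 (X w).
    by rewrite (fs _ Xs).
have fZ : (\int[P]_w (f (Z K w))%:E)%E @[K --> \oo] --> (\int[P']_w (f (Psi w))%:E)%E.
  apply: Z_Psi => //; exists 1 => x.
  by have /andP[f0 f1] := f01 x; rewrite ger0_norm.
have /andP[Psi1 Psi2] := bounds _ _ P' Psi (@measurable_funPT _ _ _ _ Psi).
split.
  apply: le_trans Psi1 _; apply: lee_cvg_to fZ Pgs _; apply: nearW => K.
  by have /andP[] := bounds _ _ P _ (mZ K).
apply: le_trans _ Psi2; apply: lee_cvg_to Pga fZ _; apply: nearW => K.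
by have /andP[] := bounds _ _ P _ (mZ K).
Qed.

(** Thresholds are written [u^(1/b)], so that the limit survival function becomes
    [exp (- l u)], continuous in [u] also at [0]; letting [u] tend to [t] from
    both sides in [cvg_in_distribution_tails] determines the tail at [t]. *)
Lemma cvg_in_distribution_weibull (l b : R) : 0 < l -> 0 < b ->
  (forall a, 0 < a ->
    P [set w | a <= Z K w] @[K --> \oo] --> (expR (- (l * a `^ b)))%:E) ->
  forall t, 0 <= t ->
    P' [set w | t `^ b^-1 < Psi w] = (expR (- (l * t)))%:E.
Proof.
move=> l0 b0 Zl t t0.
have mge u : measurable [set w | u <= Psi w] by exact: measurable_ge.
have mgt u : measurable [set w | u < Psi w] by exact: measurable_gt.
have root u : 0 <= u -> (u `^ b^-1) `^ b = u.
  by move=> u0; rewrite -powRrM mulVf ?gt_eqF// powRr1.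
have rootlt u v : 0 <= u -> u < v -> u `^ b^-1 < v `^ b^-1.
  by move=> u0 uv; apply: gt0_ltr_powR; rewrite ?invr_gt0// nnegrE// ltW// (le_lt_trans u0).
have Zr u : 0 < u ->
    P [set w | u `^ b^-1 <= Z K w] @[K --> \oo] --> (expR (- (l * u)))%:E.
  by move=> u0; have := Zl _ (powR_gt0 b^-1 u0); rewrite root// ltW.
have fin : P' [set w | t `^ b^-1 < Psi w] \is a fin_num by rewrite fin_num_measure.
have cexp (F : set_system R) (FF : ProperFilter F) : F --> t ->
    expR (- (l * u)) @[u --> F] --> expR (- (l * t)).
  move=> Ft; apply: continuous_cvg; first exact: continuous_expR.
  by apply: cvgN; apply: cvgM => //; exact: cvg_cst.
apply/eqP; rewrite eq_le -(fineK fin) !lee_fin; apply/andP; split.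
  move: t0; rewrite le_eqVlt => /predU1P[<-|t0].
    rewrite mulr0 oppr0 expR0 -lee_fin fineK ?fin_num_measure//.
    exact: probability_le1.
  apply: (cvgr_to_ge (cexp t^'- _ _)); first by apply: cvg_within.
  near=> u; have u0 : 0 < u by near: u; exact: nbhs_left_gt.
  have ut : u < t by near: u; exact: nbhs_left_lt.
  have [+ _] := cvg_in_distribution_tails (rootlt _ _ (ltW u0) ut) (Zr _ u0) (Zr _ t0).
  rewrite -lee_fin fineK//; apply: le_trans; rewrite le_measure// ?inE// => w.
  exact: ltW.
apply: (cvgr_to_le (cexp t^'+ _ _)); first by apply: cvg_within.
near=> v; have tv : t < v by near: v; exact: nbhs_right_gt.
pose u := (t + v) / 2.
have tu : t < u by rewrite /u; lra.
have uv : u < v by rewrite /u; lra.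
have u0 : 0 < u by exact: le_lt_trans tu.
have [_] := cvg_in_distribution_tails (rootlt _ _ (ltW u0) uv) (Zr _ u0)
  (Zr _ (lt_trans u0 uv)).
rewrite -lee_fin fineK//; move=> /le_trans; apply; rewrite le_measure// ?inE// => w.
by apply: lt_le_trans; exact: rootlt.
Unshelve. all: by end_near. Qed.

End marginal.

(** Rays generate the Borel sets.  The tail at [t = 0] shows that [Psi] is positive
    almost surely, hence that its power [b] is only evaluated at positive
    arguments, up to a null set. *)
Lemma exponential_law (R : realType) (d : measure_display)
    (T : measurableType d) (P : probability T R) (Psi : {RV P >-> R})
    (l b : R) : 0 < l -> 0 < b ->
  (forall t, 0 <= t -> P [set w | t `^ b^-1 < Psi w] = (expR (- (l * t)))%:E) ->
  forall A, measurable A -> P [set w | A (Psi w `^ b)] = exponential_prob l A.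
Proof.
move=> l0 b0 tailE A mA; rewrite -(exponential_measureE l0).
have mY : measurable_fun setT (fun w => Psi w `^ b : measurableTypeR R).
  exact: (measurableT_comp (measurable_powR b) (@measurable_funPT _ _ _ _ Psi)).
have mPsi := @measurable_funPT _ _ _ _ Psi.
have Psi_pos : P (~` [set w | 0 < Psi w]) = 0%E.
  have := tailE 0 (lexx 0).
  rewrite powR0 ?invr_eq0 ?gt_eqF// mulr0 oppr0 expR0 => P1.
  rewrite probability_setC; last exact: measurable_gt.
  by rewrite P1 subee.
change (image_measure P mY A = exponential_measure l0 A).
apply: (@measure_unique _ R (measurableTypeR R) (@RGenOInfty.G R)
  (fun N => `]- N%:R, +oo[%classic) _ _ _ _ (image_measure P mY)
  (exponential_measure l0)) => //.
- exact: RGenOInfty.measurableE.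
- move=> _ _ [x ->] [y ->]; exists (Num.max x y).
  apply/seteqP; split=> z; rewrite /= !in_itv/= !andbT gt_max.
    by move=> [-> ->].
  by move=> /andP[].
- by move=> N; exists (- N%:R).
- rewrite -subTset => x _; exists (Num.truncn `|x|).+1 => //=.
  rewrite in_itv/= andbT; have := truncnS_gt `|x|.
  by rewrite ltr_norml => /andP[].
- move=> _ [x ->]; rewrite exponential_measureE exponential_prob_ray//.
  rewrite /image_measure/= /pushforward.
  have -> : (fun w => Psi w `^ b) @^-1` `]x, +oo[ = [set w | x < Psi w `^ b].
    by apply/seteqP; split=> w; rewrite /= in_itv/= andbT.
  case: ltP => x0.
    rewrite (_ : [set w | _] = setT) ?probability_setT//.
    by rewrite -subTset => w _ /=; rewrite (lt_le_trans x0)// powR_ge0.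
  have xroot : (x `^ b^-1) `^ b = x by rewrite -powRrM mulVf ?gt_eqF// powRr1.
  have mYx : measurable [set w | x < Psi w `^ b] by exact: (measurable_gt _ mY).
  have mPx : measurable [set w | x `^ b^-1 < Psi w] by exact: measurable_gt.
  have mP0 : measurable [set w | 0 < Psi w] by exact: measurable_gt.
  rewrite -tailE//; apply/eqP; rewrite eq_le; apply/andP; split.
    rewrite -[leRHS]adde0 -Psi_pos.
    apply: le_trans (measureU2 P mPx (measurableC mP0)).
    rewrite le_measure// ?inE//; first by apply: measurableU => //; exact: measurableC.
    move=> w /= xw; have [w0|w0] := pselect (0 < Psi w); last by right.
    left; rewrite ltNge; apply/negP => wx; move: xw; rewrite ltNge => /negP; apply.
    rewrite -[leRHS]xroot; apply: ge0_ler_powR => //; first exact: ltW.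
      by rewrite nnegrE ltW.
    by rewrite nnegrE powR_ge0.
  rewrite le_measure// ?inE// => w /= xw.
  rewrite -[ltLHS]xroot; apply: gt0_ltr_powR => //; first by rewrite nnegrE powR_ge0.
  by rewrite nnegrE (le_trans (powR_ge0 x b^-1))// ltW.
- move=> N; rewrite ltey_eq; apply/orP; left.
  by rewrite /image_measure/= /pushforward fin_num_measure//; exact: measurable_preimage.
Qed.

(** * The limit theorem *)

Section limit_theorem.
Context {R : realType} {n : nat} (hn : (2 <= n)%N).
Context {dC : measure_display} {TC : measurableType dC} (PC : probability TC R).
Variables (C : {RV PC >-> 'rV[R]_n}) (alpha : R) (h : 'rV[R]_n -> R).
Hypothesis hh : asymptotically_homogeneous PC C alpha h.
Context {d : measure_display} {T : measurableType d} (P : probability T R).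
Variable ell : nat -> 'rV[R]_n -> T -> R.
Hypothesis hell : independent_copies (closure (@simplex R n)) P PC ell
  (fun p w => dotr (C w) p).

Lemma dotr_gt0 (p x : 'rV[R]_n) : orthant p -> orthant x -> 0 < dotr p x.
Proof.
case: n hn p x => // m _ p x p0 x0; rewrite /dotr big_ord_recl ltr_wpDr ?mulr_gt0//.
by apply: sumr_ge0 => i _; rewrite mulr_ge0// ltW.
Qed.

Lemma region_union_measureE r (p : 'I_r -> 'rV[R]_n) a :
  (\int[lebesgue_rV n]_(x in region_union p a) (h x)%:E)%E =
  orthant_measure hh.1 (region_union p a).
Proof. by rewrite orthant_measure_sub// => x [i _ []]. Qed.

Lemma measurable_scaled_min_simplex K (p : 'rV[R]_n) : simplex p ->
  measurable_fun setT (scaled_min alpha ell K p).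
Proof.
move=> hp; apply: measurable_scaled_min => k.
by have [+ _ _] := hell => /(_ k p); apply; exact: subset_closure.
Qed.

(** As the thresholds decrease to [0], the union of the regions decreases to the
    empty set, so the survival function tends to [1]. *)
Lemma limit_law_positive r (p : 'I_r -> 'rV[R]_n)
    (mu : probability 'rV[R]_r R) : (forall i, simplex (p i)) ->
  (forall a, (forall i, 0 < a i) -> mu (upper_box a) =
    expeR (- orthant_measure hh.1 (region_union p a))%E) ->
  mu (~` @orthant R r) = 0%E.
Proof.
move=> hp muE; pose a k (i : 'I_r) : R := k.+1%:R^-1.
have a_le i j l : (i <= j)%N -> a j l <= a i l.
  by move=> ij; rewrite lef_pV2 ?posrE// ler_nat.
have cup : \bigcup_k upper_box (a k) = @orthant R r.
  apply/seteqP; split=> [y [k _ ya] i|y y0].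
    by apply: lt_le_trans (ya i); rewrite invr_gt0.
  exists (Num.truncn (\sum_i (y 0 i)^-1)) => // i.
  rewrite -[leRHS]invrK lef_pV2 ?posrE ?invr_gt0//.
  apply: le_trans (ltW (truncnS_gt _)); rewrite (bigD1 i)//= lerDl.
  by apply: sumr_ge0 => j _; rewrite invr_ge0 ltW.
have mua : mu (upper_box (a k)) @[k --> \oo] --> mu (@orthant R r).
  rewrite -cup; apply: nondecreasing_cvg_mu.
  - by move=> k; exact: measurable_upper_box.
  - by apply: bigcupT_measurable => k; exact: measurable_upper_box.
  - move=> i j ij; apply/subsetPset => y ya l; apply: le_trans (ya l).
    exact: a_le.
have cap : \bigcap_k region_union p (a k) = set0.
  rewrite -subset0 => x xa.
  have [i0 _ [xo _]] := xa 0%N I.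
  pose s : R := \sum_i (dotr (p i) x)^-1.
  have px i : 0 < dotr (p i) x by apply: dotr_gt0 => //; exact: simplex_orthant.
  have [i _ [_]] := xa (Num.truncn s) I.
  rewrite ltNge => /negP; apply.
  rewrite -[leRHS]invrK lef_pV2 ?posrE ?invr_gt0//.
  apply: le_trans (ltW (truncnS_gt _)); rewrite /s (bigD1 i)//= lerDl.
  by apply: sumr_ge0 => j _; rewrite invr_ge0 ltW.
have nua : orthant_measure hh.1 (region_union p (a k)) @[k --> \oo] --> 0%E.
  rewrite -[X in _ --> X](measure0 (orthant_measure hh.1)) -cap.
  apply: nonincreasing_cvg_mu.
  - by rewrite ltey_eq (region_union_fin hn hh).
  - by move=> k; exact: measurable_region_union.
  - by apply: bigcapT_measurable => k; exact: measurable_region_union.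
  - move=> i j ij; apply/subsetPset => x [l _ [xo xl]]; exists l => //; split=> //.
    exact: lt_le_trans xl (a_le _ _ _ ij).
have mu1 : mu (upper_box (a k)) @[k --> \oo] --> 1%E.
  rewrite (_ : (fun k => _) = (fun k =>
      (expR (- fine (orthant_measure hh.1 (region_union p (a k)))))%:E)); last first.
    apply/funext => k; rewrite muE => [|i]; last by rewrite invr_gt0.
    by rewrite -[in LHS](fineK (region_union_fin hn hh _ hp)).
  apply: cvg_EFin; first exact: nearW.
  have /fine_cvgP[_ nua0] := nua.
  rewrite [X in _ --> X](_ : _ = expR (- 0)); last by rewrite oppr0 expR0.
  apply: continuous_cvg; first exact: continuous_expR.
  exact: cvgN.
rewrite probability_setC; last exact: measurable_orthant.
by rewrite (cvg_unique _ mua mu1)// subee.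
Qed.

End limit_theorem.

Theorem proposition3p8 (R : realType) (n : nat) (hn : (2 <= n)%N)
    (dC : measure_display) (TC : measurableType dC) (PC : probability TC R)
    (C : {RV PC >-> 'rV[R]_n}) (hC : forall w, orthant (C w))
    (alpha : R) (h : 'rV[R]_n -> R)
    (hh : asymptotically_homogeneous PC C alpha h)
    (d : measure_display) (T : measurableType d) (P : probability T R)
    (ell : nat -> 'rV[R]_n -> T -> R)
    (hell : independent_copies (closure (@simplex R n)) P PC ell
              (fun p w => dotr (C w) p)) :
  (forall (r : nat) (hr : (0 < r)%N) (p : 'I_r -> 'rV[R]_n)
      (hp : forall i, simplex (p i)) (p_inj : injective p),
    let survival (a : 'I_r -> R) : \bar R :=
      expeR (- \int[@lebesgue_rV R n]_(x in region_union p a) (h x)%:E)%E in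
    (forall a : 'I_r -> R, (forall i, 0 < a i) ->
      P [set w | forall i, a i <= scaled_min alpha ell K (p i) w]
        @[K --> \oo] --> survival a) /\
    (exists mu : probability 'rV[R]_r R,
      forall a : 'I_r -> R, (forall i, 0 < a i) ->
        mu [set y : 'rV[R]_r | forall i, a i <= y 0 i] = survival a) /\
    (forall mu : probability 'rV[R]_r R,
      (forall a : 'I_r -> R, (forall i, 0 < a i) ->
        mu [set y : 'rV[R]_r | forall i, a i <= y 0 i] = survival a) ->
      cvg_in_distribution P
        (fun K w => \row_i scaled_min alpha ell K (p i) w) mu id)) /\
  (forall p : 'rV[R]_n, simplex p ->
    exists lambda : R,
      [/\ 0 < lambda,
          (\int[@lebesgue_rV R n]_(x in region p 1) (h x)%:E)%E = lambda%:E
        & forall (d' : measure_display) (T' : measurableType d')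
            (P' : probability T' R) (Psi : {RV P' >-> R}),
          cvg_in_distribution P (fun K w => scaled_min alpha ell K p w)
            P' Psi ->
          forall A : set R, measurable A ->
            P' [set w | A (Psi w `^ (n%:R + alpha))] =
            exponential_prob lambda A]).
Proof.
split=> [r _ p hp _ survival|p hp].
  have survivalE a :
      survival a = expeR (- orthant_measure hh.1 (region_union p a))%E.
    by rewrite /survival (region_union_measureE hh).
  have surv_cvg (a : 'I_r -> R) :
      P [set w | forall i, a i <= scaled_min alpha ell K (p i) w]
        @[K --> \oo] --> survival a.
    by rewrite survivalE; exact: survival_cvg.
  split; first by move=> a _; exact: surv_cvg.
  split=> [|mu muE].
    have [mu muE] := exists_limit_law hn hh hp.
    by exists mu => a _; rewrite survivalE; exact: muE.
  apply: upper_box_cvg_in_distribution.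
  - move=> K; apply: measurable_fun_rVP => i; under eq_fun do rewrite mxE.
    exact: (measurable_scaled_min_simplex _ hell).
  - move=> a a0; rewrite [X in _ --> X](muE a a0).
    rewrite (_ : (fun K => _) = (fun K =>
        P [set w | forall i, a i <= scaled_min alpha ell K (p i) w])).
      exact: surv_cvg.
    apply/funext => K; congr (P _).
    by apply/seteqP; split=> w wa i; have := wa i; rewrite mxE.
  - by apply: (limit_law_positive hn (hh := hh) hp) => a a0; rewrite -survivalE muE.
exists (fine (orthant_measure hh.1 (region p 1))); split.
- exact: region1_fine_gt0.
- by rewrite (fineK (region_fin hn hh _ hp)) -region_union1 (region_union_measureE hh).
move=> d' T' P' Psi ZPsi; apply: exponential_law.
- exact: region1_fine_gt0.
- exact: asymptotic_exponent_gt0 hh.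
apply: (cvg_in_distribution_weibull _ ZPsi).
- by move=> K; exact: (measurable_scaled_min_simplex _ hell).
- exact: region1_fine_gt0.
- exact: asymptotic_exponent_gt0 hh.
move=> a a0.
have : P [set w | 'I_1 -> a <= scaled_min alpha ell K p w] @[K --> \oo] -->
    expeR (- orthant_measure hh.1 (region_union (fun _ : 'I_1 => p) (fun=> a)))%E.
  by apply: (survival_cvg (hh := hh) hn hell (p := fun=> p) (a := fun=> a)) => _.
rewrite region_union1 (region_scale hn)// -[X in (_ * X)%E](fineK (region_fin hn hh _ hp)).
rewrite -EFinM mulrC (_ : (fun K => _) =
  (fun K => P [set w | a <= scaled_min alpha ell K p w]))//.
apply/funext => K; congr (P _).
by apply/seteqP; split=> w wa; [exact: (wa ord0)|move=> _].
Qed.
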